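(* Let $\operatorname{Sym}$ be the $\mathbb{Q}$-algebra of symmetric functions in the variables $t_1,t_2,\dots$, with monomial symmetric functions $m_\lambda$, elementary symmetric functions $e_i$, power sums $p_i$, and $e_\lambda=e_{\lambda_1}e_{\lambda_2}\cdots$ for a partition $\lambda=(\lambda_1,\lambda_2,\dots)$. Let $\zeta:\operatorname{Sym}\to\mathbb{R}$ be the $\mathbb{Q}$-algebra homomorphism determined by $\zeta(p_1)=\gamma$ (Euler's constant) and $\zeta(p_i)=\zeta(i)=\sum_{n\ge 1} n^{-i}$ for $i\ge 2$. Let $\{Q_i\}_{i\ge 0}$ be the multiplicative sequence of polynomials (with real coefficients) associated to the power series $Q(z)=\Gamma(1+z)^{-1}$, i.e. $$\sum_{i=0}^{\infty}Q_i(e_1,\dots,e_i)=\prod_{j=1}^{\infty}\frac{1}{\Gamma(1+t_j)},$$ where $Q_i(e_1,\dots,e_i)$ is the homogeneous component of degree $i$ in the variables $t_1,t_2,\dots$. Then for every $i$ and every partition $\lambda$ of $i$, the coefficient of $e_\lambda$ in $Q_i(e_1,\dots,e_i)$ is $\zeta(m_\lambda)$. Equivalently, $$Q_i(e_1,\dots,e_i)=\sum_{\lambda\vdash i}\zeta(m_\lambda)\,e_\lambda .$$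
   Context: $\operatorname{Sym}$ consists of the symmetric formal power series of bounded degree in countably many commuting variables $t_1,t_2,\dots$ with rational coefficients. Here $e_i$ is the $i$th elementary symmetric function ($e_0=1$), $p_i=\sum_j t_j^i$ is the $i$th power sum, and, for a partition $\lambda$, $m_\lambda$ is the monomial symmetric function, i.e. the sum of all distinct monomials in the $t_j$ whose multiset of nonzero exponents is the multiset of parts of $\lambda$. Both $\{m_\lambda\}$ and $\{e_\lambda\}$ (over all partitions $\lambda$) are vector space bases of $\operatorname{Sym}$, and $\operatorname{Sym}$ is freely generated as a commutative $\mathbb{Q}$-algebra by $p_1,p_2,\dots$, so $\zeta$ is well defined by its values on the $p_i$. The function $\Gamma(1+z)^{-1}$ is identified with its Taylor series at $z=0$, which has constant term $1$; the product $\prod_{j\ge 1}\Gamma(1+t_j)^{-1}$ is the formal infinite product, a symmetric formal power series in the $t_j$ with real coefficients. Its homogeneous component of degree $i$ (each $t_j$ having degree $1$) is a unique polynomial with real coefficients in the algebraically independent elements $e_1,\dots,e_i$; this polynomial is $Q_i$ (with $Q_0=1$). The ''coefficient of $e_\lambda$'' refers to the expansion of $Q_i(e_1,\dots,e_i)$ as a real linear combination of the monomials $e_\lambda$, $\lambda\vdash i$. *)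

(* Defs.v *)
From HB Require Import structures.
From mathcomp Require Import all_boot all_order all_algebra finmap.
(* The notations of multinomials clash with those of MathComp-Analysis. *)
From mathcomp Require Import -(notations) monalg.
From mathcomp Require Import -(notations) mpoly.
From mathcomp Require Import all_classical all_reals all_analysis.

Set Implicit Arguments.
Unset Strict Implicit.
Unset Printing Implicit Defensive.

Import Order.TTheory GRing.Theory Num.Theory.
Import numFieldNormedType.Exports.

Local Open Scope classical_set_scope.
Local Open Scope ring_scope.

(* Monomials in t_1, t_2, ...: finitely supported exponent functions on nat,  *)
(* the index j standing for the variable t_(j+1).                             *)
Notation monom := (cmonom nat).

Lemma monom_eq (m1 m2 : monom) : (forall i, m1 i = m2 i) -> m1 = m2.
Proof. by move=> h; apply/eqP/cmP. Qed.

(* A finite list containing, possibly strictly, the divisors of m. *)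
Definition divisors_of (m : monom) : seq monom :=
  undup (codom (fun h : {ffun finsupp m -> 'I_(monalg.mdeg m).+1} =>
    cmonom_of_fsfun cmonom_key [fsfun i : finsupp m => (h i : nat) | 0%N])).

Lemma mem_divisors_of (m k : monom) :
  (forall i, (k i <= m i)%N) -> k \in divisors_of m.
Proof.
move=> km; rewrite mem_undup; apply/codomP.
have kd i : (k i < (monalg.mdeg m).+1)%N.
  rewrite ltnS (leq_trans (km i))// /monalg.mdeg.
  case: (finsuppP m i) => // im.
  by rewrite (big_fsetD1 i)//= leq_addr.
exists [ffun i => Ordinal (kd (val i))].
apply: monom_eq => i; rewrite cmE fsfun_ffun.
case: insubP => [u iu <-|]; first by apply: esym; exact: (congr1 val (ffunE _ _)).
by rewrite memNfinsupp => /eqP mi0; move: (km i); rewrite mi0 leqn0 => /eqP ->.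
Qed.

Lemma divisors_ofP (m a b : monom) : mulcm a b = m ->
  a \in divisors_of m /\ b \in divisors_of m.
Proof.
move=> <-; split; apply: mem_divisors_of => i;
  by rewrite mulcmE ?leq_addr ?leq_addl.
Qed.

(* Formal power series in t_1, t_2, ... over R, as coefficient functions.     *)
Definition fps (R : comNzRingType) := monom -> R.

HB.instance Definition _ (R : comNzRingType) :=
  GRing.Lmodule.copy (fps R) (monom -> R^o).

Section FpsRing.
Variable R : comNzRingType.
Implicit Types f g h : fps R.

Definition fps_one : fps R := fun m => (m == onecm nat)%:R.

Definition fps_mul f g : fps R := fun m =>
  \sum_(p \in [set p : monom * monom | mulcm p.1 p.2 = m]) f p.1 * g p.2.

Lemma fps_mulE f g m (D : seq monom) : uniq D ->
  (forall a b, mulcm a b = m -> a \in D /\ b \in D) ->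
  fps_mul f g m =
  \sum_(a <- D) \sum_(b <- D) (mulcm a b == m)%:R * (f a * g b).
Proof.
move=> uD mD; pose r := [seq (a, b) | a <- D, b <- D].
have ur : uniq r by apply: allpairs_uniq => // -[a b] [c d].
rewrite /fps_mul (fsbigE [seq p <- r | mulcm p.1 p.2 == m]).
- rewrite big_filter_cond big_mkcond big_allpairs.
  apply: eq_bigr => a _; apply: eq_bigr => b _ /=.
  have [abm|abm] /= := eqVneq (mulcm a b) m; last by rewrite mul0r.
  by rewrite mem_set ?mul1r.
- exact: filter_uniq.
- by move=> p /=; rewrite mem_filter => /andP[/eqP].
- move=> [a b] /= abm; rewrite mem_filter /= abm eqxx /=.
  by have [aD bD] := mD _ _ abm; rewrite allpairs_f.
Qed.

Let fps_mulC : commutative fps_mul.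
Proof.
move=> f g; apply/funext => m; pose D := divisors_of m.
rewrite !(@fps_mulE _ _ _ D) ?undup_uniq//; try exact: (@divisors_ofP m).
rewrite exchange_big; apply: eq_bigr => a _; apply: eq_bigr => b _.
by rewrite mulcmC (mulrC (f _)).
Qed.

Let fps_mul3E f g h m : let D := divisors_of m in
  fps_mul (fps_mul f g) h m =
  \sum_(a <- D) \sum_(b <- D) \sum_(c <- D)
    (mulcm (mulcm a b) c == m)%:R * (f a * g b * h c).
Proof.
move=> D; have uD : uniq D by exact: undup_uniq.
rewrite (@fps_mulE _ _ _ D)//; last exact: (@divisors_ofP m).
transitivity (\sum_(x <- D) \sum_(c <- D) \sum_(a <- D) \sum_(b <- D)
    (mulcm x c == m)%:R * (mulcm a b == x)%:R * (f a * g b * h c)).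
  apply: eq_bigr => x _; apply: eq_bigr => c _.
  have [xcm|_] := eqVneq (mulcm x c) m; last first.
    by rewrite mul0r big1// => a _; rewrite big1// => b _; rewrite !mul0r.
  rewrite mul1r (@fps_mulE _ _ _ D)//; last first.
    move=> a b abx; split; apply: mem_divisors_of => i;
      by rewrite -xcm -abx !mulcmE -?addnA ?leq_addr// addnCA leq_addr.
  rewrite mulr_suml; apply: eq_bigr => a _.
  by rewrite mulr_suml; apply: eq_bigr => b _; rewrite mul1r !mulrA.
rewrite exchange_big/=.
under eq_bigr do rewrite exchange_big/=.
under eq_bigr do under eq_bigr do rewrite exchange_big/=.
rewrite exchange_big/=; apply: eq_bigr => a _.
rewrite exchange_big/=; apply: eq_bigr => b _; apply: eq_bigr => c _.
have [abcm|abcm] := eqVneq (mulcm (mulcm a b) c) m.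
  have [abD _] := divisors_ofP abcm.
  rewrite (bigD1_seq (mulcm a b))//= abcm !eqxx !mul1r big1 ?addr0// => x xab.
  by rewrite [mulcm a b == x]eq_sym (negbTE xab) mulr0 mul0r.
rewrite mul0r big1// => x _; have [abx|] := eqVneq (mulcm a b) x.
  by rewrite -abx (negbTE abcm) !mul0r.
by rewrite mulr0 mul0r.
Qed.

Let fps_mulA : associative fps_mul.
Proof.
move=> f g h; rewrite (fps_mulC f) (fps_mulC g h).
apply/funext => m; rewrite !fps_mul3E.
rewrite exchange_big/=; under eq_bigr do rewrite exchange_big/=.
rewrite exchange_big/=.
apply: eq_bigr => a _; apply: eq_bigr => b _; apply: eq_bigr => c _.
rewrite mulcmC (mulcmC c) mulcmA; congr (_ * _).
by rewrite mulrC (mulrC (h c)) mulrA.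
Qed.

Let fps_mul1 : left_id fps_one fps_mul.
Proof.
move=> f; apply/funext => m; pose D := divisors_of m.
have [oD mD] := divisors_ofP (mul0cm m).
rewrite (@fps_mulE _ _ _ D) ?undup_uniq//; last exact: (@divisors_ofP m).
rewrite (bigD1_seq (onecm nat)) ?undup_uniq//= [X in _ + X]big1 ?addr0.
  rewrite (bigD1_seq m) ?undup_uniq//= [X in _ + X]big1 ?addr0.
    by rewrite mul0cm /fps_one !eqxx !mul1r.
  by move=> b bm; rewrite mul0cm (negbTE bm) mul0r.
move=> a a1; rewrite big1// => b _.
by rewrite /fps_one (negbTE a1) mul0r mulr0.
Qed.

Let fps_mulDl : left_distributive fps_mul +%R.
Proof.
move=> f g h; apply/funext => m; pose D := divisors_of m.
transitivity (fps_mul f h m + fps_mul g h m) => //.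
rewrite !(@fps_mulE _ _ _ D) ?undup_uniq//; try exact: (@divisors_ofP m).
rewrite -big_split; apply: eq_bigr => a _.
by rewrite -big_split; apply: eq_bigr => b _; rewrite /= -mulrDr -mulrDl.
Qed.

Let fps_one_neq0 : fps_one != 0 :> fps R.
Proof.
apply/eqP => /(congr1 (fun f : fps R => f (onecm nat))) /eqP.
by rewrite /fps_one eqxx oner_eq0.
Qed.

HB.instance Definition _ := GRing.Zmodule_isComNzRing.Build (fps R)
  fps_mulA fps_mulC fps_mul1 fps_mulDl fps_one_neq0.

Let fps_scaleAl (c : R) f g : c *: (f * g) = (c *: f) * g.
Proof.
apply/funext => m; pose D := divisors_of m.
transitivity (c * fps_mul f g m) => //.
transitivity (fps_mul (c *: f) g m) => //.
rewrite !(@fps_mulE _ _ _ D) ?undup_uniq//; try exact: (@divisors_ofP m).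
rewrite mulr_sumr; apply: eq_bigr => a _.
rewrite mulr_sumr; apply: eq_bigr => b _.
by rewrite mulrCA; congr (_ * _); rewrite mulrA.
Qed.

HB.instance Definition _ := GRing.Lmodule_isLalgebra.Build R (fps R) fps_scaleAl.
HB.instance Definition _ := GRing.Lalgebra_isComAlgebra.Build R (fps R).

End FpsRing.

Section Symmetric.
Variable R : comNzRingType.
Implicit Types f g : fps R.

Definition symmetric_fps f : Prop :=
  forall s : nat -> nat, bijective s ->
  forall m m' : monom, (forall j, m' (s j) = m j) -> f m' = f m.

Definition bounded_degree f : Prop :=
  exists d : nat, forall m : monom, (d < monalg.mdeg m)%N -> f m = 0.

Definition is_symf : {pred fps R} :=
  fun f => `[< symmetric_fps f /\ bounded_degree f >].

Lemma is_symfP f :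
  reflect (symmetric_fps f /\ bounded_degree f) (f \in is_symf).
Proof. exact: asboolP. Qed.

Lemma rename_key : unit. Proof. exact: tt. Qed.

(* m composed with s, for t the inverse of s. *)
Definition rename (s t : nat -> nat) (m : monom) : monom :=
  cmonom_of_fsfun cmonom_key
    [fsfun[rename_key] i in [fset t j | j in finsupp m]%fset => m (s i) | 0%N].

Lemma renameE (s t : nat -> nat) (m : monom) : cancel s t -> cancel t s ->
  forall j, rename s t m j = m (s j).
Proof.
move=> st ts j; rewrite cmE fsfun_fun; case: ifPn => // jm.
case: (finsuppP m (s j)) => // sjm; case/negP: jm.
by apply/imfsetP; exists (s j); rewrite ?st.
Qed.

Let sym_subalg : subalg_closed is_symf.
Proof.
split.
- apply/is_symfP; split.
      move=> s [t st ts] m m' mm'; congr (_%:R); congr nat_of_bool.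
      apply/eqP/eqP => [m1|m1]; apply: monom_eq => j; rewrite onecmE.
        by rewrite -mm' m1 onecmE.
      by rewrite -(ts j) mm' m1 onecmE.
    exists 0%N => m dm; rewrite /GRing.one/= /fps_one.
    by have [m1|//] := eqVneq m (onecm nat); rewrite m1 (@monalg.mdeg1 nat) in dm.
- move=> c f g /is_symfP[fs [df fb]] /is_symfP[gs [dg gb]].
  apply/is_symfP; split.
    move=> s bs m m' mm'; transitivity (c * f m' + g m') => //.
    by rewrite (fs s bs _ _ mm') (gs s bs _ _ mm').
  exists (df + dg)%N => m dm; transitivity (c * f m + g m) => //.
  rewrite fb ?gb ?mulr0 ?addr0//; apply: leq_ltn_trans dm; first exact: leq_addl.
  exact: leq_addr.
move=> f g /is_symfP[fs [df fb]] /is_symfP[gs [dg gb]]; apply/is_symfP; split.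
  move=> s [t st ts] m m' mm'; rewrite /GRing.mul/= /fps_mul.
  have bs : bijective s by exists t.
  pose h (p : monom * monom) := (rename s t p.1, rename s t p.2).
  have hi : set_bij [set p : monom * monom | mulcm p.1 p.2 = m'] 
      [set p : monom * monom | mulcm p.1 p.2 = m] h.
    split.
    - move=> [a b] /= ab; apply: monom_eq => j.
      by rewrite mulcmE !(renameE _ st ts) -mm' -ab mulcmE.
    - move=> [a b] [c d] _ _ [e1 e2].
      congr (_, _); apply: monom_eq => j;
        by rewrite -(ts j) -!(renameE _ st ts) (e1, e2).
    - move=> [a b] /= ab; exists (rename t s a, rename t s b) => /=.
        apply: monom_eq => j.
        by rewrite mulcmE !(renameE _ ts st) -mulcmE ab -mm' ts.
      congr (_, _); apply: monom_eq => j;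
        by rewrite (renameE _ st ts) (renameE _ ts st) st.
  rewrite [RHS](reindex_fsbig _ _ _ _ hi); apply: eq_fsbigr => -[a b] _ /=.
  congr (_ * _).
    by apply: (fs s bs) => j; rewrite (renameE _ st ts).
  by apply: (gs s bs) => j; rewrite (renameE _ st ts).
exists (df + dg)%N => m dm; rewrite /GRing.mul/= /fps_mul fsbig1// => -[a b] /= abm.
have [da|ad] := ltnP df (monalg.mdeg a); first by rewrite fb// mul0r.
have [db|bd] := ltnP dg (monalg.mdeg b); first by rewrite gb// mulr0.
move: dm; rewrite -abm.
by rewrite (@monalg.mdegM nat a b) ltnNge leq_add.
Qed.

HB.instance Definition _ :=
  GRing.isSubalgClosed.Build R (fps R) is_symf sym_subalg.

Record Sym := MkSym { sym_val :> fps R; sym_valP : sym_val \in is_symf }.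

HB.instance Definition _ := [isSub for sym_val].
HB.instance Definition _ := [Choice of Sym by <:].
HB.instance Definition _ := [SubChoice_isSubAlgebra of Sym by <:].
HB.instance Definition _ := [SubNzRing_isSubComNzRing of Sym by <:].

End Symmetric.

Section SymmetricFunctions.
Variable R : comNzRingType.

(* t_(j+1) ^ k *)
Definition var_pow (j k : nat) : monom := expcmn (ucm j) k.

Lemma var_powE j k i : var_pow j k i = ((j == i) * k)%N.
Proof.
rewrite /var_pow /expcmn; case: k => [|k]; first by rewrite muln0 onecmE.
elim: k => [|k IHk]; first by rewrite muln1 ucmE.
transitivity (mulcm (ucm j) (iterop k.+1 (@mulcm nat) (ucm j) (onecm nat)) i) => //.
by rewrite mulcmE IHk ucmE -mulnS.
Qed.

(* e_i is the sum of the products of i distinct variables. *)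
Definition elem_fps (i : nat) : fps R := fun m =>
  ((monalg.mdeg m == i) && all (fun j => m j == 1%N) (finsupp m))%:R.

(* p_k is the sum over j of the monomials t_j ^ k; it is meaningful for k >= 1. *)
Definition power_fps (k : nat) : fps R := fun m =>
  (`[< exists j, m = var_pow j k >])%:R.

Definition monomial_fps (l : seq nat) : fps R := fun m =>
  (perm_eq [seq m j | j <- finsupp m] l)%:R.

Lemma power_fps_sym k : power_fps k \in @is_symf R.
Proof.
apply/is_symfP; split.
  move=> s [t st ts] m m' mm'; congr (nat_of_bool _)%:R; apply: asbool_equiv_eq.
  split=> -[j mE]; [exists (t j)|exists (s j)]; apply: monom_eq => i.
    by rewrite -mm' mE !var_powE -(can2_eq ts st).
  by rewrite -(ts i) mm' mE !var_powE (can_eq st).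
exists k => m km; rewrite /power_fps; case: asboolP => // -[j mE].
move: km; rewrite /monalg.mdeg.
have -> : (\sum_(i <- finsupp m) m i = \sum_(i <- finsupp m) (j == i) * k)%N.
  by apply: eq_bigr => i _; rewrite {1}mE var_powE.
rewrite -big_distrl/= ltnNge -{2}(mul1n k) leq_mul2r.
rewrite (_ : _ <= 1)%N ?orbT//.
have [js|js] := boolP (j \in finsupp m).
  by rewrite (big_fsetD1 j)//= eqxx big1_seq// => i /=; rewrite !inE; case: eqVneq.
by rewrite big1_seq// => i /= im; case: eqVneq => // ji; rewrite ji im in js.
Qed.

Lemma monomial_fps_sym l : monomial_fps l \in @is_symf R.
Proof.
apply/is_symfP; split.
  move=> s [t st ts] m m' mm'; congr (nat_of_bool _)%:R.
  have/permPl -> // :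
    perm_eq [seq m' j | j <- finsupp m'] [seq m j | j <- finsupp m].
  have/(perm_map m')/permPl -> : perm_eq (finsupp m') [seq s j | j <- finsupp m].
    apply: uniq_perm => [||j]; rewrite ?(map_inj_uniq (can_inj st)) ?fset_uniq//.
    apply/idP/mapP => [jm'|[i im ->]]; last by rewrite -cmE_neq0 mm' cmE_neq0.
    by exists (t j); rewrite ?ts// -cmE_neq0 -mm' ts cmE_neq0.
  by rewrite -map_comp (eq_map mm').
exists (sumn l) => m lm; rewrite /monomial_fps; case: (boolP (perm_eq _ _)) => //.
by move/perm_sumn => ml; move: lm; rewrite -ml sumnE big_map ltnn.
Qed.

End SymmetricFunctions.

Definition power_sym (R : comNzRingType) (k : nat) : Sym R :=
  MkSym (power_fps_sym R k).

Definition monomial_sym (R : comNzRingType) (l : seq nat) : Sym R :=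
  MkSym (monomial_fps_sym R l).

Definition is_partition (i : nat) (l : seq nat) : bool :=
  [&& sorted geq l, all (fun k => 0 < k)%N l & sumn l == i].

Definition homogeneous_component (R : comNzRingType) (i : nat) (f : fps R) :
  fps R := fun m => if monalg.mdeg m == i then f m else 0.

(* The series q(t_(j+1)), where q(z) = \sum_k q_k z^k. *)
Definition series_at (R : comNzRingType) (q : nat -> R) (j : nat) : fps R :=
  fun m => if (finsupp m `<=` [fset j])%fset then q (m j) else 0.

(* Infinite product, as the coefficientwise limit of the partial products. In *)
(* \prod_j q(t_j) with q_0 = 1 each coefficient is eventually constant.       *)
Definition fps_prod (R : realType) (F : nat -> fps R) : fps R :=
  fun m => limn (fun n => (\prod_(0 <= j < n) F j : fps R) m).

(* P(e_1, ..., e_i); the variables of P are numbered from 0. *)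
Definition eval_elem (R : comNzRingType) (i : nat) (P : mpoly i R) : fps R :=
  mmap (fun c : R => c%:A : fps R) (fun j : 'I_i => elem_fps R j.+1) P.

Definition multiplicative_sequence (R : realType) (q : nat -> R)
    (Q : forall i, mpoly i R) : Prop :=
  forall i, eval_elem (Q i) =
    homogeneous_component i (fps_prod (fun j => series_at q j)).

Definition elem_part (R : comNzRingType) (l : seq nat) : fps R :=
  \prod_(k <- l) elem_fps R k.

(* For l a partition of i, the coefficient in P of the monomial mapped to     *)
(* e_l by eval_elem, whose exponent at j is the multiplicity of j + 1 in l.   *)
Definition coef_elem_part (R : comNzRingType) (i : nat) (l : seq nat)
    (P : mpoly i R) : R :=
  mcoeff (Multinom [tuple count_mem j.+1 l | j < i]) P.

(* Euler's integral; only values at s > 0 are relevant. *)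
Definition Gamma (R : realType) (s : R) : R :=
  \int[lebesgue_measure]_(t in `]0, +oo[) (t `^ (s - 1) * expR (- t)).

(* Taylor coefficients at 0 of 1 / Gamma(1 + z), from the real derivatives. *)
Definition recip_gamma_coef (R : realType) (k : nat) : R :=
  derive1n k (fun z : R => (Gamma (1 + z))^-1) 0 / k`!%:R.

Definition euler_gamma (R : realType) : R :=
  limn (fun n => \sum_(1 <= k < n.+1) (k%:R)^-1 - ln n%:R).

Definition zeta_value (R : realType) (i : nat) : R :=
  limn (fun N => \sum_(1 <= n < N) (n%:R ^+ i)^-1 : R).

(* Main.v *)
Require Import Defs.
From HB Require Import structures.
From mathcomp Require Import all_boot all_order all_algebra finmap.
From mathcomp Require Import -(notations) monalg.
From mathcomp Require Import -(notations) mpoly.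
From mathcomp Require Import all_classical all_reals all_analysis.
From mathcomp Require Import measurable_realfun ring lra.

Set Implicit Arguments.
Unset Strict Implicit.
Unset Printing Implicit Defensive.

Import Order.TTheory GRing.Theory Num.Theory.
Import numFieldNormedType.Exports.

Local Open Scope classical_set_scope.
Local Open Scope ring_scope.

(** Both [zeta(e_k)] and the Taylor coefficients [a_k] of [1 / Gamma(1 + z)] obey
    Newton's identities. From Euler's integral, [1 / Gamma(1 + z)] is the limit of
    [n^(-z) \prod_(k <= n) (1 + z/k)]; differentiating its logarithm term by term
    gives the recurrence [k a_k = \sum_(1 <= j <= k) (-1)^(j-1) z_j a_(k-j)] with
    [z_1] Euler's constant and [z_j = zeta(j)] for [j >= 2], which is the image under
    zeta of Newton's identity for the elementary symmetric functions. Hence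
    [zeta(e_k) = a_k], and the coefficient of [t^mu] in [\prod_j 1/Gamma(1 + t_j)] is
    [zeta(e_mu)].

    The coefficient of [t^mu] in [e_lambda] is the number of 0-1 matrices with row
    sums [lambda] and column sums [mu]. It is symmetric in [lambda] and [mu] by
    transposition, so [e_mu] is the sum over lambda of [[t^mu] e_lambda] times
    [m_lambda]; applying zeta shows that [t^mu] has the same coefficient in the
    product as in [\sum_lambda zeta(m_lambda) e_lambda]. The coefficients of [e_lambda]
    are then determined by the algebraic independence of [e_1, ..., e_i]. *)

(** * Euler's integral *)

Section EulerIntegral.
Variable R : realType.
Notation mu := (@lebesgue_measure R).

(** Euler's integral is kept as an extended real, so that the functional equation can be obtained by
    monotone convergence before finiteness is known; finiteness is then deduced from it. *)
Definition gamma_integral (s : R) : \bar R :=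
  (\int[mu]_(t in `]0%R, +oo[) (t `^ (s - 1) * expR (- t))%:E)%E.

Lemma Gamma_fine (s : R) : Gamma s = fine (gamma_integral s).
Proof. by []. Qed.

Lemma measurable_gamma_integrand (D : set R) (s : R) :
  measurable_fun D (fun t : R => (t `^ (s - 1) * expR (- t))%:E).
Proof.
apply/measurable_EFinP; apply: measurable_funTS.
apply: measurable_funM; first exact: measurable_powR.
exact: measurableT_comp.
Qed.

Lemma gamma_integrand_ge0 (s t : R) : (0 <= (t `^ (s - 1) * expR (- t))%:E)%E.
Proof. by rewrite lee_fin mulr_ge0// ?powR_ge0 ?expR_ge0. Qed.

Lemma gamma_integral_ge0 (s : R) : (0 <= gamma_integral s)%E.
Proof. by apply: integral_ge0 => t _; exact: gamma_integrand_ge0. Qed.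

Lemma is_derive_expRN (x : R) : is_derive x 1 (fun t : R => - expR (- t)) (expR (- x)).
Proof.
have h : is_derive x 1 (expR \o -%R) (expR (- x) * -1) by exact: is_derive1_comp.
by have := is_deriveN h; rewrite mulrN1 opprK; exact.
Qed.

Lemma continuous_expRN : continuous (fun t : R => expR (- t)).
Proof.
by move=> x; apply: continuous_comp; [exact: opp_continuous|exact: continuous_expR].
Qed.

Lemma continuous_oppr_expRN : continuous (fun t : R => - expR (- t)).
Proof. by move=> x; apply: cvgN; exact: continuous_expRN. Qed.

(** For an integer [k >= s], the term of degree [k + 1] in the exponential series bounds the
    quotient by [(k + 1)! / n]. *)
Lemma cvg_powR_expRN (s : R) : n%:R `^ s * expR (- n%:R) @[n --> \oo] --> (0 : R).
Proof.
pose k := (Num.trunc `|s|).+1.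
have sk : s <= k%:R.
  by rewrite (le_trans (ler_norm s))// ltW// truncnS_gt.
apply: (@squeeze_cvgr _ _ _ _ (fun=> 0) (fun n : nat => k.+1`!%:R * n%:R^-1)).
- near=> n.
  have n0 : (0 < n)%N by near: n; exact: nbhs_infty_gt.
  have n0' : 0 < n%:R :> R by rewrite ltr0n.
  rewrite mulr_ge0 ?powR_ge0 ?expR_ge0//=.
  have h1 : n%:R `^ s <= n%:R ^+ k :> R.
    by rewrite -powR_mulrn// ler_powR// ler1n.
  have h2 : n%:R ^+ k.+1 / k.+1`!%:R <= expR n%:R :> R.
    by apply: le_trans (expR_ge1Dxn k (ltW n0')); rewrite lerDr.
  rewrite expRN ler_pdivrMr ?expR_gt0// (le_trans h1)//.
  by rewrite mulrAC ler_pdivlMr// -exprSr mulrC -ler_pdivrMr ?ltr0n ?fact_gt0.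
- exact: cvg_cst.
- rewrite -(mulr0 (k.+1`!%:R)); apply: cvgM; first exact: cvg_cst.
  apply/gtr0_cvgV0; last exact: cvgr_idn.
  by near=> n; rewrite ltr0n; near: n; exact: nbhs_infty_gt.
Unshelve. all: by end_near. Qed.

(** Integration by parts with [t ^ s] and [- exp (- t)]. The segment stays away from 0, where
    [t ^ s] may fail to be differentiable. *)
Lemma gamma_integral_segment_rec (s a b : R): 0 < s -> 0 < a -> a < b ->
  (\int[mu]_(t in `[a, b]) (t `^ (s + 1 - 1) * expR (- t))%:E =
   (a `^ s * expR (- a) - b `^ s * expR (- b))%:E +
   s%:E * \int[mu]_(t in `[a, b]) (t `^ (s - 1) * expR (- t))%:E)%E.
Proof.
move=> s0 a0 ab; rewrite addrK.
have itv0 (x : R) : x \in `[a, b] -> 0 < x.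
  by rewrite in_itv/= => /andP[/(lt_le_trans a0)].
have dP (x : R) : 0 < x -> {for x, continuous (fun t : R => t `^ s)}.
  move=> x0; apply: differentiable_continuous; apply/derivable1_diffP.
  by apply: derivable_powR; rewrite in_itv/= x0.
have dP' (x : R) : 0 < x -> {for x, continuous (fun t : R => s * t `^ (s - 1))}.
  move=> x0; apply: continuousM; first exact: cvg_cst.
  apply: differentiable_continuous; apply/derivable1_diffP.
  by apply: derivable_powR; rewrite in_itv/= x0.
have within (f : R -> R) : (forall x, 0 < x -> {for x, continuous f}) ->
    {within `[a, b], continuous f}.
  move=> cf; apply: continuous_in_subspaceT => x; rewrite inE => xab.
  exact/cf/itv0.
rewrite (@integration_by_parts R (fun t => t `^ s) (fun t => - expR (- t))
   (fun t => s * t `^ (s - 1)) (fun t => expR (- t)) a b ab).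
- congr (_ + _)%E; first by rewrite !mulrN opprK addrC.
  rewrite -ge0_integralZl_EFin//=.
  + under eq_integral do rewrite mulrN EFinN -mulrA EFinM.
    rewrite integral_ge0N ?oppeK// => t _.
    by rewrite mule_ge0 ?gamma_integrand_ge0 ?lee_fin ?ltW.
  + by move=> t _; exact: gamma_integrand_ge0.
  + exact: measurable_gamma_integrand.
  + exact: ltW.
- by apply: within.
- split.
  + move=> x; rewrite in_itv/= => /andP[ax _]; apply: derivable_powR.
    by rewrite in_itv/= (lt_trans a0).
  + by apply: cvg_at_right_filter; exact: dP.
  + by apply: cvg_at_left_filter; apply: dP; exact: lt_trans ab.
- move=> x; rewrite in_itv/= => /andP[ax _]; apply: powR_derive1.
  by rewrite in_itv/= (lt_trans a0).
- by apply: within => x _; exact: continuous_expRN.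
- split.
  + by move=> x _; have [] := is_derive_expRN x.
  + by apply: cvg_at_right_filter; exact: continuous_oppr_expRN.
  + by apply: cvg_at_left_filter; exact: continuous_oppr_expRN.
- by move=> x _; rewrite derive1E; have [] := is_derive_expRN x.
Qed.

(** Monotone convergence along segments that exhaust the half-line. With [n + 2] in place of
    [n + 1], the endpoints are strictly ordered already for [n = 0]. *)
Lemma gamma_integral_cvg_segments (s : R) :
  (\int[mu]_(t in `[(n.+2%:R^-1 : R)%R, n.+2%:R%R]) (t `^ (s - 1) * expR (- t))%:E)%E
    @[n --> \oo] --> gamma_integral s.
Proof.
rewrite /gamma_integral (_ : `]0%R, +oo[%classic =
    \bigcup_n `[(n.+2%:R^-1 : R), n.+2%:R]%classic).
  apply: ge0_nondecreasing_set_cvg_integral => //.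
  - move=> m n mn; apply/subsetPset => x /=; rewrite !in_itv/= => /andP[mx xm].
    apply/andP; split; last by rewrite (le_trans xm)// ler_nat.
    by rewrite (le_trans _ mx)// lef_pV2 ?posrE ?ltr0n// ler_nat.
  - by move=> n; exact: measurable_gamma_integrand.
  - by move=> n x _; exact: gamma_integrand_ge0.
apply/seteqP; split => x /=; rewrite in_itv/= ?andbT.
  move=> x0; exists (maxn (Num.trunc x) (Num.trunc x^-1)) => //=.
  rewrite in_itv/=; apply/andP; split.
    rewrite -[leRHS]invrK lef_pV2 ?posrE ?ltr0n ?invr_gt0//.
    rewrite (le_trans (ltW (truncnS_gt _)))// ler_nat -addn2 -addn1 leq_add//.
    exact: leq_maxr.
  rewrite (le_trans (ltW (truncnS_gt _)))// ler_nat -addn2 -addn1 leq_add//.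
  exact: leq_maxl.
by move=> [n _] /=; rewrite in_itv/= => /andP[+ _]; apply: lt_le_trans.
Qed.

(** The limit of the identity on segments. The boundary term at [1 / (n + 2)] vanishes because
    [s > 0], the one at [n + 2] because of the exponential decay. *)
Lemma gamma_integral_rec (s : R) : 0 < s ->
  gamma_integral (s + 1) = (s%:E * gamma_integral s)%E.
Proof.
move=> s0.
have := @gamma_integral_cvg_segments (s + 1).
under eq_fun.
  move=> n; rewrite gamma_integral_segment_rec//; last first.
    rewrite (@lt_trans _ _ 1)//; last by rewrite ltr1n.
    by rewrite invf_lt1 ?ltr1n ?ltr0n.
  over.
move=> h; apply: (cvg_unique (@ereal_hausdorff R) h).
rewrite -(add0e (s%:E * gamma_integral s)%E).
apply: cvgeD => //.
- apply: cvg_EFin; first exact: nearW.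
  rewrite -[X in _ --> X](subr0 (0 : R)); apply: cvgB.
  + apply: (@squeeze_cvgr _ _ _ _ (fun=> 0) (fun n : nat => (n.+2%:R^-1 : R) `^ s)).
    * near=> n; rewrite mulr_ge0 ?powR_ge0 ?expR_ge0//=.
      by rewrite ler_piMr ?powR_ge0// expR_le1 oppr_le0 invr_ge0.
    * exact: cvg_cst.
    * have /cvg_at_rightP := @powR_cvg0 R s s0; apply; split => //.
      by have := @cvg_harmonic R; rewrite -cvg_shiftS.
  + have := @cvg_powR_expRN s; rewrite -(cvg_shiftn 2).
    by under eq_fun do rewrite addn2.
- apply: cvgeZl => //; exact: gamma_integral_cvg_segments.
Unshelve. all: by end_near. Qed.

Lemma gamma_integral1 : gamma_integral 1 = 1%E.
Proof.
rewrite /gamma_integral subrr integral_itv_obnd_cbnd; last first.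
  by have := @measurable_gamma_integrand (`]0, +oo[) 1; rewrite subrr.
under eq_integral do rewrite powRr0 mul1r.
rewrite (@ge0_continuous_FTC2y _ _ (fun t => - expR (- t)) 0 0).
- by rewrite oppr0 expR0 sub0e -EFinN opprK.
- by move=> x _; exact: expR_ge0.
- by apply: continuous_subspaceT; exact: continuous_expRN.
- by rewrite -oppr0; apply: cvgN; exact: cvgr_expR.
- by move=> x _; have [] := is_derive_expRN x.
- by apply: cvg_at_right_filter; exact: continuous_oppr_expRN.
- by move=> x _; rewrite derive1E; have [] := is_derive_expRN x.
Qed.
End EulerIntegral.

(** * Convexity bound, finiteness and positivity of Gamma *)

Section GammaBounds.
Variable R : realType.
Notation mu := (@lebesgue_measure R).

(** With [y = ln x], the point [u = w * y] is the mean of [y] and 0 with weights [w] and [1 - w].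
    The tangent to the exponential at [u] lies below its graph at both points, and the weighted sum
    of these two inequalities is the claim. *)
Lemma powR_bernoulli (w x : R) : 0 <= w <= 1 -> 0 < x -> x `^ w <= 1 - w + w * x.
Proof.
move=> /andP[w0 w1] x0; set y := ln x; have xE : x = expR y by rewrite lnK.
have -> : x `^ w = expR (w * y) by rewrite /powR gt_eqF.
rewrite xE; set u := w * y.
have h1 : expR u * (1 + (y - u)) <= expR y.
  by rewrite -{2}(subrKC u y) expRD ler_pM2l ?expR_gt0 ?expR_ge1Dx.
have h2 : expR u * (1 - u) <= 1.
  have := expR_ge1Dx (- u); rewrite -(ler_pM2l (expR_gt0 u)) => /le_trans; apply.
  by rewrite -expRD subrr expR0.
have e : expR u = w * (expR u * (1 + (y - u))) + (1 - w) * (expR u * (1 - u)).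
  by rewrite /u; ring.
rewrite {1}e addrC lerD// ?ler_wpM2l//.
by rewrite -[leRHS]mulr1 ler_wpM2l// subr_ge0.
Qed.

(* Integrate Bernoulli's inequality for [(t / a) `^ w]. *)
Lemma gamma_integral_powR_le (a w : R) : 0 < a -> 0 <= w <= 1 ->
  (gamma_integral (a + w) <= (a `^ w)%:E * gamma_integral a)%E.
Proof.
move=> a0 w01; have /andP[w0 w1] := w01.
have aw0 : 0 <= a `^ w by exact: powR_ge0.
have c1 : 0 <= a `^ w * (1 - w) by rewrite mulr_ge0// subr_ge0.
have c2 : 0 <= a `^ w * (w / a) by rewrite mulr_ge0// divr_ge0// ltW.
(* The functional equation splits the right side into the integrals of the two terms [1 - w] and
   [w * (t / a)] of Bernoulli's bound. *)
rewrite [leRHS](_ : _ = (a `^ w * (1 - w))%:E * gamma_integral a +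
                        (a `^ w * (w / a))%:E * gamma_integral (a + 1))%E; last first.
  rewrite gamma_integral_rec// muleA -EFinM -ge0_muleDl ?lee_fin//; last first.
    by rewrite mulr_ge0// ltW.
  by rewrite -EFinD; congr (_%:E * _)%E; rewrite -!mulrA mulVf ?gt_eqF//; ring.
rewrite /gamma_integral -!ge0_integralZl_EFin//; last 4 first.
- by move=> t _; exact: gamma_integrand_ge0.
- exact: measurable_gamma_integrand.
- by move=> t _; exact: gamma_integrand_ge0.
- exact: measurable_gamma_integrand.
rewrite -ge0_integralD//; last 4 first.
- by move=> t _; apply: mule_ge0; [rewrite lee_fin|exact: gamma_integrand_ge0].
- by apply: emeasurable_funM => //; exact: measurable_gamma_integrand.
- by move=> t _; apply: mule_ge0; [rewrite lee_fin|exact: gamma_integrand_ge0].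
- by apply: emeasurable_funM => //; exact: measurable_gamma_integrand.
apply: ge0_le_integral => //.
- by move=> t _; exact: gamma_integrand_ge0.
- exact: measurable_gamma_integrand.
- by apply: emeasurable_funD; apply: emeasurable_funM => //; exact: measurable_gamma_integrand.
move=> t /=; rewrite in_itv/= andbT => t0.
rewrite lee_fin addrK.
have t0' : t != 0 by rewrite gt_eqF.
rewrite (_ : a + w - 1 = a - 1 + w); last by ring.
rewrite powRD; last by rewrite t0' implybT.
have -> : t `^ a = t `^ (a - 1) * t.
  by rewrite mulrC mulr_powRB1// ltW.
have -> : t `^ w = a `^ w * (t / a) `^ w.
  by rewrite -powRM ?divr_ge0 ?ltW// mulrC divfK// gt_eqF.
have := powR_bernoulli w01 (divr_gt0 t0 a0).
have k0 : 0 <= t `^ (a - 1) * a `^ w * expR (- t).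
  by rewrite !mulr_ge0 ?powR_ge0 ?expR_ge0.
move=> /(ler_wpM2l k0) h.
apply: le_trans (le_trans h _); rewrite le_eqVlt; apply/orP; left; apply/eqP; ring.
Qed.

(** For [s <= 1], the convexity bound from [a = 1] makes the integral at [s + 1] at most 1, and this
    integral is [s] times the one at [s]. Larger [s] are reduced to [s - 1] by the functional
    equation. *)
Lemma gamma_integral_fin (s : R) : 0 < s -> gamma_integral s \is a fin_num.
Proof.
have : s <= (Num.trunc s).+1%:R by rewrite ltW// truncnS_gt.
move: (Num.trunc s) => n; elim: n s => [s s1 s0|n IHn s sn s0].
  have : (gamma_integral (1 + s) <= 1)%E.
    have := @gamma_integral_powR_le 1 s ltr01.
    by rewrite gamma_integral1 powR1 mule1; apply; rewrite ltW.
  have := gamma_integral_ge0 s; rewrite addrC gamma_integral_rec//.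
  by case: gamma_integral => //; rewrite gt0_muley// lte_fin.
have [s1|s1] := leP s 1; first by apply: IHn => //; rewrite (le_trans s1)// ler1n.
rewrite -(subrK 1 s) gamma_integral_rec ?subr_gt0// fin_numM// IHn ?subr_gt0//.
by rewrite lerBlDr natr1.
Qed.

Lemma Gamma1 : Gamma 1 = 1 :> R.
Proof. by rewrite Gamma_fine gamma_integral1. Qed.

Lemma GammaD1 (s : R) : 0 < s -> Gamma (s + 1) = s * Gamma s.
Proof.
by move=> s0; rewrite !Gamma_fine gamma_integral_rec// fineM// gamma_integral_fin.
Qed.

Lemma Gamma_powR_le (a w : R) : 0 < a -> 0 <= w <= 1 ->
  Gamma (a + w) <= a `^ w * Gamma a.
Proof.
move=> a0 w01; rewrite !Gamma_fine -lee_fin EFinM !fineK ?gamma_integral_fin//.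
  exact: gamma_integral_powR_le.
by have /andP[w0 _] := w01; rewrite ltr_wpDr.
Qed.

(** For [s <= 1], moving up from [s] by [1 - s] gives [1 = Gamma 1 <= s ^ (1 - s) * Gamma s]. The
    functional equation handles the rest. *)
Lemma Gamma_gt0 (s : R) : 0 < s -> 0 < Gamma s.
Proof.
have : s <= (Num.trunc s).+1%:R by rewrite ltW// truncnS_gt.
move: (Num.trunc s) => n; elim: n s => [s s1 s0|n IHn s sn s0].
  have := @Gamma_powR_le s (1 - s) s0; rewrite subrKC Gamma1.
  rewrite subr_ge0 s1 gerBl ltW// => /(_ isT) /(lt_le_trans ltr01).
  by rewrite pmulr_rgt0// powR_gt0.
have [s1|s1] := leP s 1; first by apply: IHn => //; rewrite (le_trans s1)// ler1n.
rewrite -(subrK 1 s) GammaD1 ?subr_gt0// mulr_gt0 ?IHn ?subr_gt0//.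
by rewrite lerBlDr natr1.
Qed.

Lemma Gamma_shift (z : R) n : -1 < z ->
  Gamma (n.+1%:R + z) = Gamma (1 + z) * \prod_(0 <= k < n) (k.+1%:R + z).
Proof.
move=> z1; elim: n => [|n IHn]; first by rewrite big_nil mulr1.
rewrite big_nat_recr//= mulrA -IHn -[n.+2%:R]natr1 addrAC GammaD1; first by rewrite mulrC.
have : 1 <= n.+1%:R :> R by rewrite ler1n.
lra.
Qed.

Lemma Gamma_nat n : Gamma n.+1%:R = n`!%:R :> R.
Proof.
have := @Gamma_shift 0 n; rewrite !addr0 ltrN10 Gamma1 mul1r => -> //.
rewrite fact_prod natr_prod big_add1.
by apply: eq_bigr => k _; rewrite addr0.
Qed.

End GammaBounds.

(** * Differentiation of limits *)

Section DeriveLimit.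
Variable R : realType.

(** A form of the mean value theorem that is symmetric in the two points, so that increments of
    either sign are treated alike. *)
Lemma MVT_ball (f df : R -> R) (r x y : R) :
  (forall z : R, `|z| < r -> is_derive z 1 f (df z)) -> `|x| < r -> `|y| < r ->
  exists c, [/\ `|c| < r, `|c - x| <= `|y - x|, `|c - y| <= `|y - x| &
    f y - f x = df c * (y - x)].
Proof.
wlog xy : x y / x <= y.
  move=> wl fd xr yr; have [/wl|yx] := leP x y; first exact.
  have [c [cr cy cx E]] := wl _ _ (ltW yx) fd yr xr.
  exists c; split => //; rewrite 1?(distrC y x)//.
  by rewrite -(opprB (f x)) E -mulrN opprB.
move=> fd xr yr.
have itvr c : c \in `[x, y]%R -> `|c| < r.
  move: xr yr; rewrite !ltr_norml in_itv/= => /andP[xr _] /andP[_ yr] /andP[xc cy].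
  by rewrite (lt_le_trans xr)// (le_lt_trans cy).
have [c cxy E] : exists2 c, c \in `[x, y]%R & f y - f x = df c * (y - x).
  apply: MVT_segment => // [c cxy|].
    by apply/fd/itvr; apply: subset_itv_oo_cc.
  apply: derivable_within_continuous => c cxy.
  by have [] := fd _ (itvr _ cxy).
exists c; move: (cxy); rewrite in_itv/= => /andP[xc cy]; split => //.
- exact: itvr.
- by rewrite !ger0_norm ?subr_ge0// lerD2r.
- by rewrite distrC !ger0_norm ?subr_ge0// lerD2l lerN2.
Qed.

Lemma is_derive_quadratic (f : R -> R) (z d C e : R) : 0 < e ->
  (forall h, `|h| < e -> `|f (z + h) - f z - h * d| <= C * h ^+ 2) ->
  is_derive z 1 f d.
Proof.
move=> e0 fE.
(* [C] may be zero or negative; this replacement can be divided by. *)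
have C0 : 0 < `|C| + 1 by rewrite ltr_wpDl.
have lim : h^-1 *: (f (h *: 1 + z) - f z) @[h --> 0^'] --> d.
  apply/cvgrPdist_le => eps eps0; near=> h.
  have h0 : h != 0 by near: h; exact: nbhs_dnbhs_neq.
  have he : `|h| < e.
    by near: h; apply: dnbhs0_lt.
  have heps : `|h| < eps / (`|C| + 1).
    by near: h; apply: dnbhs0_lt; rewrite divr_gt0.
  have -> : d - h^-1 *: (f (h *: 1 + z) - f z) =
      - (h^-1 * (f (z + h) - f z - h * d)).
    by rewrite /GRing.scale/= mulr1 [h + z]addrC [h^-1 * (_ - h * d)]mulrBr mulKf// opprB.
  rewrite normrN normrM normfV ler_pdivrMl ?normr_gt0//.
  rewrite (le_trans (fE _ he))// -real_normK ?num_real// expr2 mulrCA.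
  rewrite ler_pM2l ?normr_gt0//.
  apply: (@le_trans _ _ ((`|C| + 1) * `|h|)).
    by rewrite ler_wpM2r// (le_trans (ler_norm _))// lerDl.
  by rewrite mulrC -ler_pdivlMr// ltW.
apply: DeriveDef; last exact/cvg_lim.
by apply/cvg_ex; exists d.
Unshelve. all: by end_near. Qed.

(* By the mean value theorem applied twice, [F n (z + h) - F n z - h * G n z] *)
(* is at most [C * h ^+ 2] for all n, and this passes to the limit.           *)
Lemma is_derive_lim (F G H : nat -> R -> R) (f g : R -> R) (r C z : R) :
  (forall n (z : R), `|z| < r -> is_derive z 1 (F n) (G n z)) ->
  (forall n (z : R), `|z| < r -> is_derive z 1 (G n) (H n z)) ->
  (forall n (z : R), `|z| < r -> `|H n z| <= C) ->
  (forall z : R, `|z| < r -> F n z @[n --> \oo] --> f z) ->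
  (forall z : R, `|z| < r -> G n z @[n --> \oo] --> g z) ->
  `|z| < r -> is_derive z 1 f (g z).
Proof.
move=> FG GH HC Ff Gg zr.
apply: (@is_derive_quadratic _ _ _ C (r - `|z|)); first by rewrite subr_gt0.
move=> h hr; have zhr : `|z + h| < r.
  by rewrite (le_lt_trans (ler_normD _ _))// -ltrBrDl.
have lim := cvg_norm (cvgB (cvgB (Ff _ zhr) (Ff _ zr)) (cvgM (cvg_cst h) (Gg _ zr))).
apply: (cvgr_to_le (lim _ _ _ _ _)).
apply: nearW => n.
change (`|F n (z + h) - F n z - h * G n z| <= C * h ^+ 2).
have [c [cr cz _ ->]] := MVT_ball (FG n) zr zhr.
have [d [dr dz _ GE]] := MVT_ball (GH n) zr cr.
rewrite addrAC subrr add0r in cz *.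
rewrite mulrC -mulrBr GE !normrM mulrCA expr2.
have C0 : 0 <= C by rewrite (le_trans _ (HC n z zr)).
rewrite (@le_trans _ _ (C * (`|h| * `|h|)))//.
  by rewrite ler_pM// ?mulr_ge0// ?HC// ler_wpM2l.
by rewrite -normrM ger0_norm// -expr2 sqr_ge0.
Qed.

End DeriveLimit.

(** * Euler's product for 1 / Gamma(1 + z) *)

Section EulerLimit.
Variable R : realType.

Lemma ln_Gamma_le (a w : R) : 0 < a -> 0 <= w <= 1 ->
  ln (Gamma (a + w)) <= w * ln a + ln (Gamma a).
Proof.
move=> a0 w01; have /andP[w0 _] := w01.
rewrite -ln_powR -lnM ?posrE ?powR_gt0 ?Gamma_gt0// ler_ln ?Gamma_powR_le//.
  by rewrite posrE Gamma_gt0// ltr_wpDr.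
by rewrite posrE mulr_gt0 ?powR_gt0 ?Gamma_gt0.
Qed.

Lemma ln_sub_le (a b : R) : 0 < a -> 0 < b -> ln b - ln a <= (b - a) / a.
Proof.
move=> a0 b0; rewrite -ln_div ?posrE// (_ : b / a = 1 + (b - a) / a); last first.
  by field; rewrite gt_eqF.
apply: le_ln1Dx; rewrite ltr_pdivlMr//; lra.
Qed.

(** All four bounds come from the convexity inequality [ln_Gamma_le]. From above, [y = n + 1 + z] is
    reached from [n + 1] if [z >= 0] and from [n] otherwise; from below, one moves from [y] up to
    [n + 2] or [n + 1] respectively. As [n < y < n + 2], replacing the logarithms that occur by
    [ln n] costs at most a multiple of [1 / n]. *)
Lemma ln_Gamma_asymp (z : R) n : (0 < n)%N -> `|z| < 1 ->
  `|ln (Gamma (n.+1%:R + z)) - ln n`!%:R - z * ln n%:R| <= 2 * n%:R^-1.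
Proof.
move=> n0; rewrite ltr_norml => /andP[z0 z1].
have N0 : 0 < n%:R :> R by rewrite ltr0n.
have N1 : n.+1%:R = n%:R + 1 :> R by rewrite natr1.
set y := n.+1%:R + z; have y0 : 0 < y by rewrite /y N1; lra.
have I0 : 0 < n%:R^-1 :> R by rewrite invr_gt0.
have ny : ln n%:R <= ln y by rewrite ler_ln ?posrE// /y N1; lra.
have yn : ln y - ln n%:R <= 2 * n%:R^-1.
  apply: le_trans (ln_sub_le N0 y0) _; rewrite ler_wpM2r ?ltW// /y N1; lra.
have GS (m : nat) : ln (Gamma m.+2%:R) = ln (m.+1%:R : R) + ln (Gamma (m.+1%:R : R)).
  rewrite -natr1 GammaD1 ?ltr0n// lnM ?posrE ?Gamma_gt0 ?ltr0n//.
rewrite -Gamma_nat ler_norml; apply/andP; have [zge|zlt] := leP 0 z; split.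
- have w01 : 0 <= 1 - z <= 1 by apply/andP; split; lra.
  have := @ln_Gamma_le y (1 - z) y0 w01.
  rewrite (_ : y + (1 - z) = n.+2%:R); last by rewrite /y -natr1; ring.
  rewrite GS; have : ln n%:R <= ln n.+1%:R :> R by rewrite ler_ln ?posrE ?ltr0n// ler_nat.
  have : 0 <= z * (ln y - ln n%:R) by rewrite mulr_ge0// subr_ge0.
  lra.
- have w01 : 0 <= z <= 1 by apply/andP; split; lra.
  have := @ln_Gamma_le n.+1%:R z _ w01; rewrite ltr0n -/y => /(_ isT).
  have : ln n.+1%:R - ln n%:R <= n%:R^-1 :> R.
    by have := @ln_sub_le n%:R n.+1%:R N0; rewrite ltr0n N1 addrAC subrr add0r mul1r; exact.
  move/(ler_wpM2l zge); have := ler_wpM2r (ltW I0) (ltW z1); lra.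
- have w01 : 0 <= - z <= 1 by apply/andP; split; lra.
  have := @ln_Gamma_le y (- z) y0 w01; rewrite addrK.
  have := ler_wpM2r (_ : 0 <= ln y - ln n%:R) (ltW z0).
  rewrite subr_ge0 => /(_ ny); lra.
(* Here the inequality starts at [n] with weight [1 + z], so [n] is written as a successor to let
   [GS] relate the two Gamma values. *)
- case: n n0 N0 N1 @y y0 I0 ny yn => // n _ N0 N1 y y0 I0 ny yn.
  have w01 : 0 <= 1 + z <= 1 by apply/andP; split; lra.
  have := @ln_Gamma_le n.+1%:R (1 + z) N0 w01.
  rewrite (_ : _ + (1 + z) = y); last by rewrite /y N1; ring.
  rewrite GS; move: I0; set i := _^-1.
  set p := ln (Gamma y); set q := ln (Gamma _); set r := ln _.
  lra.
Qed.

Lemma ln_prod_nat (f : nat -> R) n : (forall k, 0 < f k) ->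
  ln (\prod_(0 <= k < n) f k) = \sum_(0 <= k < n) ln (f k).
Proof.
move=> f0; elim: n => [|n IHn]; first by rewrite !big_nil ln1.
by rewrite !big_nat_recr//= lnM ?IHn ?posrE// prodr_gt0.
Qed.

(** For [n >= 1], the logarithm of Euler's product [n^(-z) \prod_(1 <= k <= n) (1 + z/k)]. *)
Definition log_gamma_approx (n : nat) (z : R) : R :=
  \sum_(0 <= k < n) ln (k.+1%:R + z) - ln n`!%:R - z * ln n%:R.

Lemma cvg_log_gamma_approx (z : R) : `|z| < 1 ->
  log_gamma_approx n z @[n --> \oo] --> - ln (Gamma (1 + z)).
Proof.
move=> z1; have := z1; rewrite ltr_norml => /andP[zN1 _].
apply/cvgrPdist_le => e e0; near=> n.
have n0 : (0 < n)%N by near: n; exact: nbhs_infty_gt.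
(* By the functional equation iterated [n] times, the error is exactly the quantity estimated in
   [ln_Gamma_asymp]. *)
have -> : - ln (Gamma (1 + z)) - log_gamma_approx n z =
    - (ln (Gamma (n.+1%:R + z)) - ln n`!%:R - z * ln n%:R).
  rewrite Gamma_shift// lnM ?posrE; last 2 first.
  - by rewrite Gamma_gt0//; lra.
  - rewrite big_seq prodr_gt0// => k _.
    have : 1 <= k.+1%:R :> R by rewrite ler1n.
    lra.
  rewrite /log_gamma_approx.
  rewrite ln_prod_nat; first by ring.
  move=> k; have : 1 <= k.+1%:R :> R by rewrite ler1n.
  lra.
rewrite normrN (le_trans (ln_Gamma_asymp n0 z1))//.
rewrite -ler_pdivlMl// -[leRHS]invrK lef_pV2 ?posrE ?ltr0n ?invr_gt0 ?mulr_gt0//.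
near: n; exact: nbhs_infty_ger.
Unshelve. all: by end_near. Qed.

End EulerLimit.

(** * Derivatives of the logarithm of Gamma as limits of finite sums *)

Section PolygammaSums.
Variable R : realType.

Lemma sum_inv_square_le n : \sum_(0 <= k < n) (k.+1%:R^-1 ^+ 2) <= 2 :> R.
Proof.
(* The bound is strengthened so that induction applies: with [x = n + 1], the increment
   [2/x - 2/(x + 1)] is at least [1/x^2] because [x >= 1]. *)
suff : \sum_(0 <= k < n) (k.+1%:R^-1 ^+ 2) <= 2 - 2 * n.+1%:R^-1 :> R.
  by move/le_trans; apply; rewrite gerBl mulr_ge0// invr_ge0.
elim: n => [|n IHn]; first by rewrite big_nil invr1; lra.
rewrite big_nat_recr//= (le_trans (lerD IHn (lexx _)))//.
have x0 : 0 < n.+1%:R :> R by [].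
have x1 : 1 <= n.+1%:R :> R by rewrite ler1n.
rewrite -[n.+2%:R]natr1; move: x0 x1; set x := n.+1%:R => x0 x1.
rewrite -subr_ge0 (_ : _ - _ = (x - 1) / (x ^+ 2 * (x + 1))).
  by rewrite divr_ge0 ?subr_ge0// mulr_ge0 ?sqr_ge0//; lra.
by field; rewrite !gt_eqF//; lra.
Qed.

Lemma sum_inv_square_bound (u : nat -> R) C n :
  (forall k, 0 <= u k <= C * k.+1%:R^-1 ^+ 2) ->
  0 <= \sum_(0 <= k < n) u k <= 2 * C.
Proof.
move=> uC; have C0 : 0 <= C.
  by have /andP[] := uC 0; rewrite invr1 expr1n mulr1; exact: le_trans.
rewrite sumr_ge0/=; last by move=> k _; have /andP[] := uC k.
rewrite (@le_trans _ _ (\sum_(0 <= k < n) C * k.+1%:R^-1 ^+ 2))//.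
  by apply: ler_sum => k _; have /andP[] := uC k.
by rewrite -mulr_sumr mulrC ler_wpM2r// sum_inv_square_le.
Qed.

Lemma is_cvg_inv_square_bound (u : nat -> R) C :
  (forall k, 0 <= u k <= C * k.+1%:R^-1 ^+ 2) ->
  cvgn (fun n => \sum_(0 <= k < n) u k).
Proof.
move=> uC; apply: nondecreasing_is_cvgn.
  apply/nondecreasing_seqP => n; rewrite big_nat_recr//= lerDl.
  by have /andP[] := uC n.
by exists (2 * C) => _ [n _ <-]; have /andP[] := sum_inv_square_bound n uC.
Qed.

(** The inequality [ln b - ln a <= (b - a) / a] for consecutive integers, used in the two orders,
    shows that the sequence decreases and is bounded below by 0. *)
Lemma is_cvg_euler_gamma :
  cvgn (fun n => \sum_(0 <= k < n) k.+1%:R^-1 - ln n%:R : R).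
Proof.
(* The term of index 0 is dropped: since [ln 0 = 0] by convention, the sequence first rises from 0
   to 1. *)
suff : cvgn (fun n => \sum_(0 <= k < n.+1) k.+1%:R^-1 - ln n.+1%:R : R).
  case/cvg_ex => /= l.
  rewrite (cvg_shiftS (fun n => \sum_(0 <= k < n) k.+1%:R^-1 - ln n%:R : R)) => ul.
  by apply/cvg_ex; exists l.
apply: nonincreasing_is_cvgn.
  apply/nonincreasing_seqP => n; rewrite [in leLHS]big_nat_recr//=.
  have := @ln_sub_le R n.+2%:R n.+1%:R; rewrite !ltr0n => /(_ isT isT).
  rewrite (_ : (_ - _) / _ = - n.+2%:R^-1); last first.
    by rewrite -[X in _ - X]natr1 opprD addrA subrr add0r mulN1r.
  by move: (ln _) (ln _) (_^-1) (\sum_(_ <= _ < _) _) => p q i S; lra.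
exists 0 => _ [n _ <-] /=; rewrite subr_ge0.
apply: (@le_trans _ _ (ln n.+2%:R)).
  by rewrite ler_ln ?posrE ?ltr0n// ler_nat.
elim: n.+1 => {n} [|n IHn]; first by rewrite big_nil ln1.
rewrite big_nat_recr//=; apply: le_trans (lerD IHn (lexx _)).
have := @ln_sub_le R n.+1%:R n.+2%:R; rewrite !ltr0n => /(_ isT isT).
rewrite (_ : (_ - _) / _ = n.+1%:R^-1).
  by move: (ln _) (ln _) (_^-1) => p q i; lra.
by rewrite -[n.+2%:R]natr1 addrAC subrr add0r mul1r.
Qed.

(* The derivatives of [log_gamma_approx n], from the first one on. *)
Definition polygamma_approx (j n : nat) (z : R) : R :=
  (-1) ^+ j * j`!%:R * \sum_(0 <= k < n) (k.+1%:R + z)^-1 ^+ j.+1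
  - (if j is 0 then ln n%:R else 0).

(** Near 0 this is the [j]-th derivative of [- psi (1 + z)], with [psi] the digamma function; the
    sign is opposite to that of the usual polygamma functions. *)
Definition polygamma (j : nat) (z : R) : R :=
  limn (fun n => polygamma_approx j n z).

Lemma is_derive_sum_nat (f : nat -> R -> R) (df : nat -> R) (z : R) n :
  (forall k, is_derive z 1 (f k) (df k)) ->
  is_derive z 1 (fun x => \sum_(0 <= k < n) f k x) (\sum_(0 <= k < n) df k).
Proof.
move=> fd; elim: n => [|n IHn].
  under eq_fun do rewrite big_nil.
  by rewrite big_nil; exact: is_derive_cst.
under eq_fun do rewrite big_nat_recr//=.
by rewrite big_nat_recr//=; exact: is_deriveD.
Qed.

Lemma shift_gt0 k (z : R) : `|z| < 1 -> 0 < k.+1%:R + z.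
Proof.
rewrite ltr_norml => /andP[z0 _]; have : 1 <= k.+1%:R :> R by rewrite ler1n.
lra.
Qed.

Lemma is_derive_shift1 (c z : R) : is_derive z 1 (fun x => c + x) 1.
Proof.
have := @is_deriveD _ _ _ (cst c) id z 1 0 1.
by rewrite add0r; apply.
Qed.

Lemma is_derive_log_gamma_approx n (z : R) : `|z| < 1 ->
  is_derive z 1 (log_gamma_approx n) (polygamma_approx 0 n z).
Proof.
move=> z1; rewrite /polygamma_approx expr0 fact0 !mul1r.
have h1 : is_derive z 1 (fun x => \sum_(0 <= k < n) ln (k.+1%:R + x))
    (\sum_(0 <= k < n) (k.+1%:R + z)^-1 ^+ 1).
  apply: is_derive_sum_nat => k; rewrite expr1 -[_^-1]mulr1.
  apply: (@is_derive1_comp _ (@ln R) (fun x => k.+1%:R + x)).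
    by apply: is_derive1_ln; exact: shift_gt0.
  exact: is_derive_shift1.
have h2 : is_derive z 1 (fun x => x * ln n%:R) (ln n%:R).
  have := @is_deriveM _ _ id (cst (ln n%:R)) z 1 1 0.
  by rewrite scaler0 add0r /GRing.scale/= mulr1; apply.
have h3 := is_deriveB h1 (is_derive_cst (ln n`!%:R) z 1).
have := is_deriveB h3 h2; rewrite subr0.
exact.
Qed.

Lemma is_derive_polygamma_approx j n (z : R) : `|z| < 1 ->
  is_derive z 1 (polygamma_approx j n) (polygamma_approx j.+1 n z).
Proof.
move=> z1.
have h1 : is_derive z 1 (fun x => \sum_(0 <= k < n) (k.+1%:R + x)^-1 ^+ j.+1)
    (\sum_(0 <= k < n) (- j.+1%:R * (k.+1%:R + z)^-1 ^+ j.+2)).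
  apply: is_derive_sum_nat => k.
  have k0 := shift_gt0 k z1.
  have dV := @is_deriveV _ _ z 1 _ (lt0r_neq0 k0) (is_derive_shift1 k.+1%:R z).
  rewrite (_ : (fun x : R => _) = (fun x => (k.+1%:R + x)^-1) ^+ j.+1); last first.
    by apply/funext => x; rewrite exprfctE.
  have := @is_deriveX _ _ _ j.+1 z 1 _ dV.
  move/is_derive_eq; apply; rewrite /GRing.scale/= mulr1 -exprVn.
  by rewrite mulrN mulNr -mulrA -exprD addn2.
have := is_deriveB (is_deriveZ ((-1) ^+ j * j`!%:R) h1)
  (is_derive_cst (if j is 0 then ln n%:R else 0) z 1).
move/is_derive_eq; apply; rewrite subr0 /polygamma_approx subr0 -mulr_sumr.
by rewrite /GRing.scale/= mulrA factS natrM exprS; ring.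
Qed.

(** Radius 1/2 keeps [k + 1 + z] above half of [k + 1] for every [k], which gives bounds uniform in
    [z]. *)
Lemma inv_shift_bound k (z : R) : `|z| < 2^-1 ->
  0 <= (k.+1%:R + z)^-1 <= 2 * k.+1%:R^-1.
Proof.
move=> z1; have z1' : `|z| < 1 by rewrite (lt_trans z1)// invf_lt1// ltr1n.
have k0 := shift_gt0 k z1'; rewrite invr_ge0 ltW//=.
rewrite -[leRHS]invrK lef_pV2 ?posrE ?invr_gt0 ?mulr_gt0 ?invr_gt0//.
rewrite invfM invrK.
have : 1 <= k.+1%:R :> R by rewrite ler1n.
move: z1; rewrite ltr_norml => /andP[]; lra.
Qed.

Lemma inv_shift_pow_bound j k (z : R) : `|z| < 2^-1 ->
  0 <= (k.+1%:R + z)^-1 ^+ j.+2 <= 2 ^+ j.+2 * k.+1%:R^-1 ^+ 2.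
Proof.
move=> /(inv_shift_bound k)/andP[h0 h1]; rewrite exprn_ge0//=.
apply: (@le_trans _ _ ((2 * k.+1%:R^-1) ^+ j.+2)); first by
  apply: lerXn2r => //; rewrite nnegrE// mulr_ge0// invr_ge0.
rewrite exprMn ler_wpM2l ?exprn_ge0// -addn2 exprD ler_piMl ?exprn_ge0 ?invr_ge0//.
by rewrite exprn_ile1 ?invr_ge0// invf_le1// ler1n.
Qed.

Lemma polygamma_approx_bound j n (z : R) : `|z| < 2^-1 ->
  `|polygamma_approx j.+1 n z| <= j.+1`!%:R * (2 * 2 ^+ j.+2).
Proof.
move=> z1; rewrite /polygamma_approx subr0 !normrM normrX normrN1 expr1n mul1r.
rewrite normr_nat ler_wpM2l//.
have /andP[? ?] := sum_inv_square_bound n (fun k => inv_shift_pow_bound j k z1).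
by rewrite ger0_norm.
Qed.

Lemma cvg_polygamma j (z : R) : `|z| < 2^-1 ->
  polygamma_approx j n z @[n --> \oo] --> polygamma j z.
Proof.
move=> z1; suff : cvgn (fun n => polygamma_approx j n z) by [].
have z1' : `|z| < 1 by rewrite (lt_trans z1)// invf_lt1// ltr1n.
case: j => [|j]; rewrite /polygamma_approx; last first.
  apply: is_cvgB; last exact: is_cvg_cst.
  apply: is_cvgM; first exact: is_cvg_cst.
  exact: is_cvg_inv_square_bound (fun k => inv_shift_pow_bound j k z1).
(* For [j = 0] the series itself diverges. Subtracting the harmonic terms, via
   [1/(x + z) = 1/x - z/(x (x + z))], leaves Euler's constant and a series dominated by inverse
   squares. *)
rewrite (_ : (fun n => _) = (fun n =>
    (\sum_(0 <= k < n) k.+1%:R^-1 - ln n%:R) -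
    z * \sum_(0 <= k < n) (k.+1%:R^-1 * (k.+1%:R + z)^-1))).
  apply: is_cvgB; first exact: is_cvg_euler_gamma.
  apply: is_cvgM; first exact: is_cvg_cst.
  apply: (@is_cvg_inv_square_bound _ 2) => k.
  have /andP[h0 h1] := inv_shift_bound k z1.
  apply/andP; split; first by rewrite mulr_ge0// invr_ge0.
  by rewrite expr2 mulrCA ler_wpM2l// invr_ge0.
apply/funext => n; rewrite expr0 fact0 !mul1r addrAC; congr (_ - _).
rewrite mulr_sumr -sumrB; apply: eq_bigr => k _.
have := shift_gt0 k z1'; have : 0 < k.+1%:R :> R by [].
by move: k.+1%:R => x x0 xz; field; rewrite !gt_eqF.
Qed.

Lemma polygamma0 j : polygamma j.+1 0 = (-1) ^+ j.+1 * j.+1`!%:R * zeta_value R j.+2.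
Proof.
rewrite /polygamma /zeta_value.
have c : cvgn (fun n => \sum_(0 <= k < n) k.+1%:R^-1 ^+ j.+2 : R).
  apply: (@is_cvg_inv_square_bound _ (2 ^+ j.+2)) => k.
  have := @inv_shift_pow_bound j k 0; rewrite addr0; apply.
  by rewrite normr0 invr_gt0.
have -> : (fun n => polygamma_approx j.+1 n 0) =
  (fun n => (-1) ^+ j.+1 * j.+1`!%:R * (\sum_(0 <= k < n) k.+1%:R^-1 ^+ j.+2)).
  apply/funext => n; rewrite /polygamma_approx subr0; congr (_ * _).
  by apply: eq_bigr => k _; rewrite addr0.
rewrite limM//; last exact: is_cvg_cst.
rewrite lim_cst//; congr (_ * _); apply/esym/cvg_lim => //.
(* The partial sums in [zeta_value] stop before their upper index, so a shift by one matches them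
   with the sums here. *)
rewrite -cvg_shiftS/=; apply: cvg_trans c.
by under eq_fun do [rewrite big_add1/=; under eq_bigr do rewrite -exprVn].
Qed.

Lemma polygamma00 : polygamma 0 0 = euler_gamma R.
Proof.
rewrite /polygamma /euler_gamma; congr (limn _); apply/funext => n.
rewrite /polygamma_approx expr0 fact0 !mul1r big_add1/=; congr (_ - _).
by apply: eq_bigr => k _; rewrite addr0 expr1.
Qed.

Lemma is_derive_polygamma j (z : R) : `|z| < 2^-1 ->
  is_derive z 1 (polygamma j) (polygamma j.+1 z).
Proof.
have lt1 (x : R) : `|x| < 2^-1 -> `|x| < 1.
  by move=> /lt_trans; apply; rewrite invf_lt1// ltr1n.
apply: (@is_derive_lim _ (polygamma_approx j) (polygamma_approx j.+1)
  (polygamma_approx j.+2)).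
- by move=> n x /lt1; exact: is_derive_polygamma_approx.
- by move=> n x /lt1; exact: is_derive_polygamma_approx.
- by move=> n x; exact: polygamma_approx_bound.
- by move=> x; exact: cvg_polygamma.
- by move=> x; exact: cvg_polygamma.
Qed.

(** Euler's limit is differentiated on the logarithmic scale, where products are sums, and then
    composed with the exponential. *)
Lemma is_derive_recip_Gamma (z : R) : `|z| < 2^-1 ->
  is_derive z 1 (fun x => (Gamma (1 + x))^-1) ((Gamma (1 + z))^-1 * polygamma 0 z).
Proof.
have lt1 (x : R) : `|x| < 2^-1 -> `|x| < 1.
  by move=> /lt_trans; apply; rewrite invf_lt1// ltr1n.
move=> z1.
have dln : is_derive z 1 (fun x : R => - ln (Gamma (1 + x))) (polygamma 0 z).
  move: z1.
  apply: (@is_derive_lim _ (@log_gamma_approx R) (polygamma_approx 0) (polygamma_approx 1)).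
  - by move=> n x /lt1; exact: is_derive_log_gamma_approx.
  - by move=> n x /lt1; exact: is_derive_polygamma_approx.
  - by move=> n x; exact: polygamma_approx_bound.
  - by move=> x /lt1; exact: cvg_log_gamma_approx.
  - by move=> x; exact: cvg_polygamma.
have expE (x : R) : `|x| < 1 -> expR (- ln (Gamma (1 + x))) = (Gamma (1 + x))^-1.
  move=> /(shift_gt0 0) x0; rewrite -lnV ?posrE ?Gamma_gt0// lnK// posrE.
  by rewrite invr_gt0 Gamma_gt0.
have dexp := @is_derive1_comp _ (@expR R) _ z _ _ (is_derive_expR _) dln.
rewrite expE in dexp; last exact: lt1.
apply: near_eq_is_derive dexp.
near=> x; rewrite /= expE//; apply: lt1.
near: x; exact: cvgr_norm_lt cvg_id _ z1.
Unshelve. all: by end_near. Qed.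

End PolygammaSums.

(** * Taylor coefficients of 1 / Gamma(1 + z) *)

Section RecipGammaCoef.
Variable R : realType.

(** Pascal's rule, in the form needed for the inductive step of Leibniz' rule. *)
Lemma binomial_shift_sum (a : nat -> R) k :
  \sum_(0 <= j < k.+1) 'C(k, j)%:R * (a j + a j.+1) =
  \sum_(0 <= j < k.+2) 'C(k.+1, j)%:R * a j.
Proof.
under eq_bigr do rewrite mulrDr.
rewrite big_split/= [RHS]big_nat_recl// bin0 mul1r.
under [in RHS]eq_bigr do rewrite binS natrD mulrDl.
rewrite big_split/= addrA; congr (_ + _).
rewrite [RHS]addrC [in RHS]big_nat_recr//= bin_small// mul0r addr0.
by rewrite big_nat_recl// bin0 mul1r addrC.
Qed.

(* Leibniz' rule for [f' = f * g 0], where [g j] is the j-th derivative of [g 0]. *)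
Lemma is_derive_derive1n (f : R -> R) (g : nat -> R -> R) (r : R) :
  (forall z : R, `|z| < r -> is_derive z 1 f (f z * g 0 z)) ->
  (forall j (z : R), `|z| < r -> is_derive z 1 (g j) (g j.+1 z)) ->
  forall k (z : R), `|z| < r -> is_derive z 1 (derive1n k f)
    (\sum_(0 <= j < k.+1) 'C(k, j)%:R * (derive1n (k - j) f z * g j z)).
Proof.
move=> fd gd; elim/ltn_ind => -[_ z zr|k IHk z zr].
  by rewrite big_nat1 bin0 mul1r; exact: fd.
have DE j x : (j <= k)%N -> `|x| < r -> derive1n j.+1 f x =
    \sum_(0 <= i < j.+1) 'C(j, i)%:R * (derive1n (j - i) f x * g i x).
  by move=> jk xr; rewrite derive1nS derive1E; have [] := IHk j jk x xr.
have D j : (j <= k)%N -> is_derive z 1 (derive1n j f) (derive1n j.+1 f z).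
  by move=> jk; rewrite DE//; exact: IHk.
pose S (x : R) := \sum_(0 <= j < k.+1) 'C(k, j)%:R * (derive1n (k - j) f x * g j x).
apply: (@near_eq_is_derive _ _ _ S).
  near=> x; rewrite DE//; near: x; exact: cvgr_norm_lt cvg_id _ zr.
rewrite -(binomial_shift_sum (fun j => derive1n (k.+1 - j) f z * g j z)).
apply: is_derive_sum_nat => j.
(* [is_derive_sum_nat] asks for a derivative at every index; beyond [k] the binomial coefficient is
   zero. *)
have [jk|kj] := leqP j k; last first.
  rewrite bin_small// mul0r; under eq_fun do rewrite mul0r.
  exact: is_derive_cst.
have := is_deriveZ 'C(k, j)%:R (is_deriveM (D _ (leq_subr j k)) (gd j z zr)).
move/is_derive_eq; apply; rewrite /GRing.scale/= subSn// subSS -derive1nS; ring.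
Unshelve. all: by end_near. Qed.

Lemma recip_gamma_coef0 : recip_gamma_coef R 0 = 1.
Proof. by rewrite /recip_gamma_coef derive1n0 addr0 Gamma1 invr1 mulr1. Qed.

(** Leibniz' rule at 0 divided by [k!]: the binomial coefficient times the factor [j!] of
    [polygamma j 0] is [k! / (k - j)!], which turns derivatives into Taylor coefficients. *)
Lemma recip_gamma_coef_rec k :
  k.+1%:R * recip_gamma_coef R k.+1 =
  \sum_(0 <= j < k.+1) (-1) ^+ j *
    (if j is 0 then euler_gamma R else zeta_value R j.+1) *
    recip_gamma_coef R (k - j).
Proof.
have lt0 : `|0 : R| < 2^-1 by rewrite normr0 invr_gt0.
have [_] := is_derive_derive1n (@is_derive_recip_Gamma R) (@is_derive_polygamma R) k lt0.
rewrite -derive1E -derive1nS => E.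
rewrite /recip_gamma_coef E factS natrM invfM.
rewrite mulrCA mulVKf ?pnatr_eq0// mulr_suml.
rewrite !big_nat; apply: eq_bigr => j; rewrite ltnS => /= jk.
have -> : polygamma j (0 : R) = (-1) ^+ j * j`!%:R *
    (if j is 0 then euler_gamma R else zeta_value R j.+1).
  by case: j jk => [|j] jk; rewrite ?polygamma00 ?polygamma0// expr0 fact0 !mul1r.
have := bin_fact jk => /(congr1 (fun n => n%:R : R)); rewrite !natrM => <-.
set c := 'C(k, j)%:R; set u := j`!%:R; set v := (k - j)`!%:R.
set w := (if _ is 0 then _ else _).
have c0 : c != 0 by rewrite pnatr_eq0 -lt0n bin_gt0.
have u0 : u != 0 by rewrite pnatr_eq0 -lt0n fact_gt0.
have v0 : v != 0 by rewrite pnatr_eq0 -lt0n fact_gt0.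
by field; rewrite c0 u0 v0.
Qed.

End RecipGammaCoef.

(** * Truncation of power series to polynomials *)

Section Transfer.
Variable R : comNzRingType.

Lemma mono_key : unit. Proof. exact: tt. Qed.

Definition mono n (k : multinom n) : monom :=
  cmonom_of_fsfun cmonom_key
    [fsfun[mono_key] i in seq_fset mono_key (iota 0 n) => nth 0%N k i | 0%N].

Lemma monoE n (k : multinom n) i : mono k i = nth 0%N k i.
Proof.
rewrite cmE fsfun_fun; case: ifPn => //.
rewrite seq_fsetE mem_iota/= add0n -leqNgt => ni.
by rewrite nth_default// size_tuple.
Qed.

Lemma mono_ord n (k : multinom n) (i : 'I_n) : mono k i = k i.
Proof. by rewrite monoE -mnm_nth. Qed.

Lemma mono_inj n : injective (@mono n).
Proof. by move=> k l kl; apply/mnmP => i; rewrite -!mono_ord kl. Qed.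

Lemma monoD n (k l : multinom n) : mono (mnm_add k l) = mulcm (mono k) (mono l).
Proof.
apply: monom_eq => i; rewrite mulcmE; have [ni|lin] := leqP n i.
  by rewrite !monoE !nth_default// size_tuple.
by rewrite !(mono_ord _ (Ordinal lin)) mnmDE.
Qed.

Lemma mono0 n : mono (@mnm0 n) = onecm nat.
Proof.
apply: monom_eq => i; rewrite onecmE; have [ni|lin] := leqP n i.
  by rewrite monoE nth_default// size_tuple.
by rewrite (mono_ord _ (Ordinal lin)) mnm0E.
Qed.

Definition restr n (m : monom) : multinom n := Multinom [tuple m i | i < n].

Lemma mono_restr n (m : monom) : (forall i, i \in finsupp m -> (i < n)%N) ->
  mono (restr n m) = m.
Proof.
move=> mn; apply: monom_eq => i; have [ni|lin] := leqP n i.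
  rewrite monoE nth_default ?size_tuple//; apply/esym/eqP.
  by rewrite cmE_eq0; apply/negP => /mn; rewrite ltnNge ni.
by rewrite (mono_ord _ (Ordinal lin)) multinomE tnth_mktuple.
Qed.

Definition msupp_bound (m : monom) : nat := (\max_(i <- finsupp m) i).+1.

Lemma mono_restr_bound (m : monom) : mono (restr (msupp_bound m) m) = m.
Proof. by apply: mono_restr => i im; rewrite ltnS; apply: leq_bigmax_seq. Qed.

Lemma mdeg_mono n (k : multinom n) : monalg.mdeg (mono k) = mdeg k.
Proof.
rewrite (@monalg.mdegEw _ _ (seq_fset mono_key (iota 0 n))); last first.
  apply/fsubsetP => i; rewrite -cmE_neq0 monoE seq_fsetE mem_iota/= add0n.
  by rewrite ltnNge; apply: contra => ni; rewrite nth_default// size_tuple.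
rewrite (perm_big (index_iota 0 n)) ?big_mkord ?mpoly.mdegE/=; last first.
  apply: uniq_perm => [||i]; [exact: fset_uniq|exact: iota_uniq|].
  by rewrite seq_fsetE /index_iota subn0.
by apply: eq_bigr => i _; rewrite mono_ord.
Qed.

(* [p] is the series obtained from [f] by setting t_(n+1) = t_(n+2) = ... = 0. *)
Definition truncates n (f : fps R) (p : mpoly n R) : Prop :=
  forall k : multinom n, f (mono k) = mcoeff k p.

(** Each monomial involves finitely many variables, so a series is determined by its truncations.
    Identities between polynomials in [n] variables, valid for all [n], thus pass to series. *)
Lemma truncates_eq (f g : fps R) :
  (forall n, exists2 p : mpoly n R, truncates f p & truncates g p) -> f = g.
Proof.
move=> fg; apply/funext => m; rewrite -(mono_restr_bound m).
by have [p -> ->] := fg (msupp_bound m).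
Qed.

Lemma truncates1 n : truncates 1 (1 : mpoly n R).
Proof. by move=> k; rewrite mcoeff1 -(inj_eq (@mono_inj n)) mono0. Qed.

Lemma truncatesD n f g (p q : mpoly n R) :
  truncates f p -> truncates g q -> truncates (f + g) (p + q).
Proof. by move=> fp gq k; rewrite mcoeffD -fp -gq. Qed.

Lemma truncatesZ n c f (p : mpoly n R) : truncates f p -> truncates (c *: f) (c *: p).
Proof. by move=> fp k; rewrite mcoeffZ -fp. Qed.

Lemma truncates0 n : truncates 0 (0 : mpoly n R).
Proof. by move=> k; rewrite mcoeff0. Qed.

Lemma truncates_sum n I (r : seq I) (P : pred I) (F : I -> fps R) (G : I -> mpoly n R) :
  (forall i, P i -> truncates (F i) (G i)) ->
  truncates (\sum_(i <- r | P i) F i) (\sum_(i <- r | P i) G i).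
Proof.
move=> FG; apply: (big_ind2 (@truncates n)) => //; first exact: truncates0.
by move=> *; exact: truncatesD.
Qed.

(** Both factors of a monomial in the first [n] variables again involve only these variables, so the
    two convolution sums run over the same pairs. *)
Lemma truncatesM n f g (p q : mpoly n R) :
  truncates f p -> truncates g q -> truncates (f * g) (p * q).
Proof.
move=> fp gq k; rewrite mcoeffM.
transitivity (fps_mul f g (mono k)) => //.
pose d := (mdeg k).+1.
(* All monomials in the first [n] variables of degree at most that of [k]; these include every
   divisor of [mono k]. *)
pose D := [seq mono (bmnm a) | a <- enum {: bmultinom n d}].
have uD : uniq D.
  rewrite map_inj_uniq ?enum_uniq// => a b /mono_inj ab; exact: val_inj.
have memD a b : mulcm a b = mono k -> a \in D.
  move=> abk; have amax i : i \in finsupp a -> (i < n)%N.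
    rewrite -cmE_neq0 ltnNge; apply: contra => ni.
    have := congr1 (fun m : monom => m i) abk.
    rewrite mulcmE monoE nth_default ?size_tuple// => /eqP.
    by rewrite addn_eq0 => /andP[].
  have ad : (mdeg (restr n a) < d)%N.
    rewrite -mdeg_mono mono_restr// ltnS -mdeg_mono -abk.
    by rewrite (@monalg.mdegM nat a b) leq_addr.
  apply/mapP; exists (BMultinom ad); first by rewrite mem_enum.
  by rewrite mono_restr.
rewrite (@fps_mulE _ _ _ _ D)//; last first.
  by move=> a b abk; split; [exact: memD abk|rewrite mulcmC in abk; exact: memD abk].
rewrite big_map; under eq_bigr do rewrite big_map.
rewrite !big_enum/=; under eq_bigr do rewrite big_enum/=.
rewrite pair_big/= [RHS]big_mkcond/=; apply: eq_bigr => -[a b] _ /=.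
rewrite -monoD (inj_eq (@mono_inj n)) eq_sym -fp -gq.
by case: eqP; rewrite (mul1r, mul0r).
Qed.

Lemma truncates_prod n I (r : seq I) (P : pred I) (F : I -> fps R) (G : I -> mpoly n R) :
  (forall i, P i -> truncates (F i) (G i)) ->
  truncates (\prod_(i <- r | P i) F i) (\prod_(i <- r | P i) G i).
Proof.
move=> FG; apply: (big_ind2 (@truncates n)) => //; first exact: truncates1.
by move=> *; exact: truncatesM.
Qed.

Lemma truncatesX n d f (p : mpoly n R) : truncates f p -> truncates (f ^+ d) (p ^+ d).
Proof.
move=> fp; elim: d => [|d IHd]; first by rewrite !expr0; exact: truncates1.
by rewrite !exprS; exact: truncatesM.
Qed.

Lemma truncates_elem n i : truncates (elem_fps R i) (mesym n R i).
Proof.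
move=> k; rewrite mcoeff_mesym /elem_fps mdeg_mono /mechar; congr (nat_of_bool _)%:R.
congr (_ && _); apply/allP/forallP => [k1 j|k1 j].
  have := k1 j; rewrite -cmE_neq0 mono_ord.
  by case: (k j) => // -[|l] // /(_ isT).
rewrite -cmE_neq0; have [nj|ljn] := leqP n j.
  by rewrite monoE nth_default ?size_tuple.
by have := k1 (Ordinal ljn); rewrite (mono_ord _ (Ordinal ljn)); case: (k _) => [|[|]].
Qed.

(** The exponent is positive, so distinct variables give distinct monomials. At exponent 0 the
    polynomial would be the constant [n], and the series 1. *)
Lemma truncates_power n i : truncates (power_fps R i.+1)
  (\sum_(j < n) mpolyX R (mnm1 j) ^+ i.+1).
Proof.
move=> k; rewrite raddf_sum/= /power_fps.
under eq_bigr do rewrite mcoeffXn.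
have mE (j : 'I_n) : (mnm_muln (mnm1 j) i.+1 == k) = (mono k == var_pow j i.+1).
  rewrite -(inj_eq (@mono_inj n)) eq_sym; congr (_ == _).
  apply: monom_eq => l; rewrite var_powE; have [nl|lln] := leqP n l.
    rewrite monoE nth_default ?size_tuple// (_ : nat_of_ord j == l = false) ?mul0n//.
    by apply/negbTE; rewrite neq_ltn (leq_trans (ltn_ord j) nl).
  by rewrite (mono_ord _ (Ordinal lln)) mulmnE mnm1E -val_eqE.
under eq_bigr do rewrite mE.
case: asboolP => [[j kj]|nk]; last first.
  rewrite big1// => j _; case: eqP => // kj; case: nk; by exists j.
have jn : (j < n)%N.
  rewrite ltnNge; apply/negP => nj.
  have := congr1 (fun m : monom => m j) kj.
  by rewrite monoE nth_default ?size_tuple// var_powE eqxx mul1n.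
rewrite (bigD1 (Ordinal jn))//= kj eqxx big1 ?addr0// => l lj.
have lj' : (nat_of_ord l == j) = false by exact: negbTE.
suff -> : (var_pow j i.+1 == var_pow l i.+1) = false by [].
apply/eqP => e; have := var_powE l i.+1 j.
by rewrite -e var_powE eqxx lj' mul1n mul0n.
Qed.

End Transfer.

(** * Newton's identities and products of elementary symmetric functions *)

Section Newton.
Variables (A : comNzRingType) (I : finType) (x : I -> A).

Definition elem_sum (k : nat) := \sum_(h : {set I} | #|h| == k) \prod_(i in h) x i.

Let U (k : nat) (i : I) := \sum_(h : {set I} | (#|h| == k) && (i \in h)) \prod_(j in h) x j.

Let U0 i : U 0 i = 0.
Proof.
by rewrite /U big1// => h /andP[]; rewrite finset.cards_eq0 => /eqP ->; rewrite inE.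
Qed.

(** Removing [i] from a set of size [k + 1] that contains it leaves a set of size [k] that avoids
    it. *)
Let US k i : U k.+1 i = x i * (elem_sum k - U k i).
Proof.
rewrite /elem_sum (bigID (fun h : {set I} => i \in h))/= -/(U k i) addrAC subrr add0r.
rewrite mulr_sumr /U.
rewrite (reindex_onto (fun h : {set I} => i |: h) (fun h => h :\ i))/=; last first.
  by move=> h /andP[_ ih]; rewrite finset.setD1K.
apply: eq_big => h.
  rewrite finset.setU11 andbT; have [ih|ih] := boolP (i \in h).
    rewrite andbF; apply/negbTE/negP => /andP[_ /eqP E].
    by move: ih; rewrite -E finset.setD11.
  by rewrite finset.setU1K// eqxx !andbT finset.cardsU1 ih add1n eqSS.
move=> /andP[_ /eqP E]; rewrite finset.big_setU1//= -E.
by rewrite finset.setD11.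
Qed.

Let U_alt k i :
  U k.+1 i = \sum_(0 <= j < k.+1) (-1) ^+ j * elem_sum (k - j)%N * x i ^+ j.+1.
Proof.
elim: k => [|k IHk].
  by rewrite US U0 subr0 big_nat1 subnn expr0 mul1r expr1 mulrC.
rewrite US IHk [RHS]big_nat_recl// expr0 mul1r expr1 subn0 mulrBr mulrC.
congr (_ + _); rewrite mulr_sumr -sumrN; apply: eq_bigr => j _.
by rewrite subSS !exprS; ring.
Qed.

(** In the sum of [U k.+1 i] over [i], each product of [k + 1] variables occurs once for each of its
    factors. Unrolling the recursion [US] writes the same sum in terms of power sums. *)
Lemma newton_identity k :
  k.+1%:R * elem_sum k.+1 =
  \sum_(0 <= j < k.+1) (-1) ^+ j * elem_sum (k - j)%N * (\sum_i x i ^+ j.+1).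
Proof.
transitivity (\sum_i U k.+1 i); last first.
  under eq_bigr do rewrite U_alt.
  by rewrite exchange_big/=; apply: eq_bigr => j _; rewrite -mulr_sumr.
rewrite /U (exchange_big_dep (fun h : {set I} => #|h| == k.+1))/=; last first.
  by move=> i h _ /andP[].
rewrite mulr_sumr; apply: eq_bigr => h hk.
by rewrite hk sumr_const (eqP hk) mulr_natl.
Qed.

End Newton.

Section ElementaryProducts.
Variable R : comNzRingType.

Lemma elem_fps0 : elem_fps R 0 = 1.
Proof.
apply/funext => m; rewrite /elem_fps (@monalg.mdeg_eq0 nat).
transitivity ((m == onecm nat)%:R : R) => //; congr (nat_of_bool _)%:R.
have [->|//] := eqVneq m _; rewrite andTb; apply/allP => j.
by rewrite -cmE_neq0 onecmE.
Qed.

Definition exponents (m : monom) : seq nat := [seq m j | j <- finsupp m].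

Lemma sumn_exponents (m : monom) : sumn (exponents m) = monalg.mdeg m.
Proof. by rewrite sumnE big_map. Qed.

Lemma elem_fps_monomial k : elem_fps R k = monomial_fps R (nseq k 1%N).
Proof.
apply/funext => m; congr (nat_of_bool _)%:R.
rewrite -sumn_exponents -/(exponents m).
rewrite -(all_map (fun j => m j) (pred1 1%N)) -/(exponents m).
set s := exponents m; apply/andP/idP => [[/eqP sk /all_pred1P s1]|sk].
  by move: sk; rewrite s1 sumn_nseq mul1n => <-.
by rewrite (perm_sumn sk) sumn_nseq mul1n (perm_all _ sk) all_nseq eqxx orbT.
Qed.

Lemma prod_exponents (A : comNzRingType) (F : nat -> A) (m : monom) n :
  F 0 = 1 -> (forall i, i \in finsupp m -> (i < n)%N) ->
  \prod_(0 <= j < n) F (m j) = \prod_(k <- exponents m) F k.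
Proof.
move=> F0 mn; rewrite big_map (bigID (fun j => j \in finsupp m))/=.
rewrite [X in _ * X]big1 ?mulr1; last first.
  by move=> j; rewrite -cmE_eq0 => /eqP ->.
rewrite -big_filter; apply: perm_big; apply: uniq_perm.
- by rewrite filter_uniq// iota_uniq.
- exact: fset_uniq.
move=> j; rewrite mem_filter mem_index_iota leq0n/=.
by case: (boolP (j \in _)) => //= /mn ->.
Qed.

(** Zero entries do not matter because [e_0 = 1]; an exponent vector can therefore serve as a list
    of row sums. *)
Lemma elem_part_mono n (k : multinom n) :
  elem_part R k = elem_part R (exponents (mono k)).
Proof.
rewrite /elem_part -(prod_exponents elem_fps0 (n := n)); last first.
  move=> i; rewrite -cmE_neq0 monoE ltnNge; apply: contra => ni.
  by rewrite nth_default// size_tuple.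
rewrite big_mkord big_tuple; apply: eq_bigr => i _.
by rewrite mono_ord.
Qed.

(* The coefficient counts the 0-1 matrices with row sums [l] and column sums [k]. *)
Lemma elem_part_matrices a n (l : multinom a) (k : multinom n) :
  elem_part R l (mono k) =
  (\sum_(H : {ffun 'I_a -> {set 'I_n}})
    ([forall i, #|H i| == l i] &&
     [forall j, (\sum_i (j \in H i))%N == k j]))%:R.
Proof.
have tr : truncates (elem_part R l) (\prod_(i < a) mesym n R (l i)).
  rewrite /elem_part big_tuple; apply: truncates_prod => i _.
  exact: truncates_elem.
rewrite tr; under eq_bigr do rewrite mesymE.
(* Expanding the product selects a set [H i] of columns for each row [i]; the exponent of the [j]-th
   variable is then the number of rows whose set contains [j]. *)
rewrite bigA_distr_big_dep/= raddf_sum natr_sum.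
rewrite big_mkcond; apply: eq_bigr => H _ /=.
have -> : (H \in family (fun (i : 'I_a) (h : {set 'I_n}) => #|h| == l i)) =
    [forall i, #|H i| == l i].
  by apply/familyP/forallP.
case: ifP => // _; rewrite mprodXE mcoeffX; congr (nat_of_bool _)%:R.
apply/eqP/forallP => [<- j|Hk].
  by rewrite mnm_sumE; apply/eqP/eq_bigr => i _; rewrite mnmE.
apply/mnmP => j; rewrite mnm_sumE -(eqP (Hk j)).
by apply: eq_bigr => i _; rewrite mnmE.
Qed.

Lemma elem_part_transpose a n (l : multinom a) (k : multinom n) :
  elem_part R l (mono k) = elem_part R k (mono l).
Proof.
rewrite !elem_part_matrices; congr (_%:R).
pose T a n (H : {ffun 'I_a -> {set 'I_n}}) := [ffun j => finset (fun i => j \in H i)].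
have TK b c : cancel (@T b c) (@T c b).
  by move=> H; apply/ffunP => i; apply/finset.setP => j; rewrite !ffunE inE ffunE inE.
rewrite (reindex (@T n a)); last by exists (@T a n) => H _; exact: TK.
apply: eq_bigr => H _; rewrite andbC; congr (nat_of_bool (_ && _)).
  apply: eq_forallb => j; congr (_ == _).
  rewrite -sum1_card [RHS]big_mkcond/=; apply: eq_bigr => i _.
  by rewrite ffunE inE; case: (_ \in _).
apply: eq_forallb => i; congr (_ == _).
rewrite -sum1_card [LHS]big_mkcond/=; apply: eq_bigr => j _.
by rewrite ffunE inE; case: (_ \in _).
Qed.

Lemma elem_part_exponents_sym (m1 m2 : monom) :
  elem_part R (exponents m1) m2 = elem_part R (exponents m2) m1.
Proof.
rewrite -(mono_restr_bound m1) -(mono_restr_bound m2) -!elem_part_mono.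
exact: elem_part_transpose.
Qed.

Lemma perm_elem_part (l1 l2 : seq nat) : perm_eq l1 l2 -> elem_part R l1 = elem_part R l2.
Proof. exact: perm_big. Qed.

Lemma elem_part_homog (l : seq nat) (m : monom) :
  monalg.mdeg m != sumn l -> elem_part R l m = 0.
Proof.
rewrite /elem_part; elim: l m => [|k l IHl] m ml.
  rewrite big_nil; transitivity ((m == onecm nat)%:R : R) => //.
  by rewrite -(@monalg.mdeg_eq0 nat) (negbTE ml).
rewrite big_cons; transitivity (fps_mul (elem_fps R k) (\prod_(j <- l) elem_fps R j) m) => //.
rewrite /fps_mul fsbig1// => -[a b] /= abm.
have [ak|ak] := eqVneq (monalg.mdeg a) k; last by rewrite /elem_fps (negbTE ak) mul0r.
rewrite IHl ?mulr0//; apply: contra ml => /eqP bl.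
by rewrite -abm (@monalg.mdegM nat a b) ak bl.
Qed.

End ElementaryProducts.

(** The coefficients are counts of matrices, hence the same natural numbers over any ring. This
    links [Sym rat], where zeta is defined, with the real series of the product. *)
Lemma ratr_elem_part (R : numFieldType) (l : seq nat) (m : monom) :
  ratr (elem_part rat l m) = elem_part R l m.
Proof.
rewrite -(mono_restr_bound m).
rewrite (elem_part_matrices rat (Multinom (in_tuple l))).
by rewrite (elem_part_matrices R (Multinom (in_tuple l))) ratr_nat.
Qed.

Section NewtonSym.
Variable R : comNzRingType.

Lemma truncates_nat n k : truncates k%:R (k%:R : mpoly n R).
Proof.
elim: k => [|k IHk]; first exact: truncates0.
by rewrite -!natr1; apply: truncatesD => //; exact: truncates1.
Qed.

Lemma truncates_sign n k : truncates ((-1) ^+ k) ((-1) ^+ k : mpoly n R).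
Proof.
apply: truncatesX; rewrite -[X in truncates X](scaleN1r (1 : fps R)) -(scaleN1r 1).
by apply: truncatesZ; exact: truncates1.
Qed.

Lemma newton_fps k :
  k.+1%:R * elem_fps R k.+1 =
  \sum_(0 <= j < k.+1) (-1) ^+ j * elem_fps R (k - j)%N * power_fps R j.+1.
Proof.
apply: truncates_eq => n; exists (k.+1%:R * mesym n R k.+1).
  by apply: truncatesM; [exact: truncates_nat|exact: truncates_elem].
rewrite [X in truncates _ X](newton_identity (fun i : 'I_n => mpolyX R (mnm1 i))).
apply: truncates_sum => j _; apply: truncatesM; last exact: truncates_power.
by apply: truncatesM; [exact: truncates_sign|exact: truncates_elem].
Qed.

(** Encoded as the monomial function of [(1, ..., 1)], whose membership in [Sym] is already
    established. *)
Definition elem_sym (k : nat) : Sym R := monomial_sym R (nseq k 1%N).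

Lemma elem_symE k : sym_val (elem_sym k) = elem_fps R k.
Proof. by rewrite elem_fps_monomial. Qed.

Lemma elem_sym0 : elem_sym 0 = 1.
Proof. by apply: val_inj; rewrite rmorph1 -(elem_fps0 R) -elem_symE. Qed.

Lemma newton_sym k :
  k.+1%:R * elem_sym k.+1 =
  \sum_(0 <= j < k.+1) (-1) ^+ j * elem_sym (k - j)%N * power_sym R j.+1.
Proof.
apply: val_inj; rewrite rmorphM rmorph_nat rmorph_sum.
transitivity (k.+1%:R * elem_fps R k.+1); first by rewrite -elem_symE.
rewrite newton_fps; apply: eq_bigr => j _.
by rewrite !rmorphM rmorphXn rmorphN1 -elem_symE.
Qed.

End NewtonSym.

(** * Partitions and the monomial expansion of products of elementary functions *)

Section Partitions.

(** A partition of [i] has at most [i] parts, each at most [i], so filtering this finite set of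
    sequences finds them all. *)
Definition partitions (i : nat) : seq (seq nat) :=
  undup [seq l <- [seq map (@nat_of_ord i.+1) (bseqval b) |
                     b : {bseq i of 'I_i.+1}] | is_partition i l].

Lemma size_le_sumn (l : seq nat) : all (fun k => 0 < k)%N l -> (size l <= sumn l)%N.
Proof.
elim: l => //= k l IHl /andP[k0 /IHl lS].
by rewrite -add1n leq_add.
Qed.

Lemma mem_le_sumn (l : seq nat) k : k \in l -> (k <= sumn l)%N.
Proof.
elim: l => //= j l IHl; rewrite inE => /predU1P[->|/IHl kl]; first exact: leq_addr.
exact: leq_trans (leq_addl _ _).
Qed.

Lemma mem_partitions i l : (l \in partitions i) = is_partition i l.
Proof.
rewrite mem_undup mem_filter andb_idr// => /and3P[_ l0 /eqP li].
have sl : (size (map (@inord i) l) <= i)%N by rewrite size_map -li size_le_sumn.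
apply/mapP; exists (Bseq sl); first by rewrite mem_enum.
rewrite /= -map_comp -[LHS]map_id; apply/eq_in_map => k kl /=.
by rewrite inordK// ltnS -li mem_le_sumn.
Qed.

Lemma uniq_partitions i : uniq (partitions i).
Proof. exact: undup_uniq. Qed.

Lemma sum_partitions (V : nmodType) i (F : seq nat -> V) :
  \sum_(l \in [set l | is_partition i l]) F l = \sum_(l <- partitions i) F l.
Proof.
rewrite (fsbigE (partitions i)) ?uniq_partitions//.
- rewrite big_seq_cond [RHS]big_seq; apply: eq_bigl => l.
  by case: (boolP (l \in _)) => //=; rewrite mem_partitions => h; rewrite mem_set.
- by move=> l /=; rewrite mem_partitions.
- by move=> l /= li; rewrite mem_partitions li.
Qed.

Lemma is_partition_sort (m : monom) :
  is_partition (monalg.mdeg m) (sort geq (exponents m)).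
Proof.
have ps : perm_eq (sort geq (exponents m)) (exponents m) by rewrite perm_sort.
apply/and3P; split.
- by apply: sort_sorted => a b; exact: leq_total.
- rewrite (perm_all _ ps); apply/allP => _ /mapP[j jm ->].
  by rewrite lt0n cmE_neq0.
- by rewrite (perm_sumn ps) sumn_exponents.
Qed.

Lemma partition_inj i l1 l2 :
  is_partition i l1 -> is_partition i l2 -> perm_eq l1 l2 -> l1 = l2.
Proof.
move=> /and3P[s1 _ _] /and3P[s2 _ _]; apply: (@sorted_eq _ geq) => //.
- by move=> a b c /= ba cb; exact: leq_trans cb ba.
- by move=> a b /= /andP[ba ab]; apply/eqP; rewrite eqn_leq ab ba.
Qed.

End Partitions.

Section FpsSums.
Variable R : comNzRingType.

Lemma fps_sumE I (r : seq I) (F : I -> fps R) (m : monom) :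
  (\sum_(i <- r) F i) m = \sum_(i <- r) F i m.
Proof. by elim: r => [|i r IHr]; rewrite ?big_nil// !big_cons -IHr. Qed.

(* Both sides have the same coefficient at each monomial by the symmetry of   *)
(* the numbers of 0-1 matrices.                                               *)
Lemma prod_elem_sym (m : monom) :
  \prod_(k <- exponents m) elem_sym R k =
  \sum_(l <- partitions (monalg.mdeg m)) elem_part R l m *: monomial_sym R l.
Proof.
apply: val_inj; rewrite rmorph_prod raddf_sum.
have -> : \prod_(k <- exponents m) val (elem_sym R k) = elem_part R (exponents m).
  by apply: eq_bigr => k _; exact: elem_symE.
apply/funext => m2.
rewrite fps_sumE elem_part_exponents_sym.
transitivity (\sum_(l <- partitions (monalg.mdeg m))
    elem_part R l m * (perm_eq (exponents m2) l)%:R); last by [].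
have [mm2|mm2] := eqVneq (monalg.mdeg m2) (monalg.mdeg m); last first.
  rewrite elem_part_homog ?sumn_exponents 1?eq_sym//.
  rewrite big_seq big1// => l; rewrite mem_partitions => /and3P[_ _ /eqP lm].
  case: (boolP (perm_eq _ _)) => [/perm_sumn|_]; last by rewrite mulr0.
  by rewrite sumn_exponents lm => /eqP; rewrite (negbTE mm2).
have p2 := is_partition_sort m2; rewrite mm2 in p2.
rewrite (bigD1_seq (sort geq (exponents m2))) ?mem_partitions ?uniq_partitions//=.
rewrite perm_sym perm_sort perm_refl mulr1 big_seq_cond big1 ?addr0.
  by rewrite (@perm_elem_part R (sort geq _) (exponents m2)) ?perm_sort.
move=> l /andP[]; rewrite mem_partitions => lp ls.
case: (boolP (perm_eq _ _)) => [sl|_]; last by rewrite mulr0.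
case/eqP: ls; apply: partition_inj lp p2 _.
by rewrite perm_sym perm_sort.
Qed.

End FpsSums.

(** * Coefficients of the infinite product *)

Section InfiniteProduct.
Variable R : realType.
Implicit Types q : nat -> R.

(** By induction on [n]: a monomial is in at most one way a product of a monomial in the first [n]
    variables and a power of the next one, so at most one term of the convolution is nonzero. *)
Lemma prod_series_at q (n : nat) (m : monom) : q 0 = 1 ->
  (\prod_(0 <= j < n) series_at q j : fps R) m =
  if all (fun j => j < n)%N (finsupp m) then \prod_(0 <= j < n) q (m j) else 0.
Proof.
move=> q0; elim: n m => [|n IHn] m.
  rewrite !big_nil; transitivity ((m == onecm nat)%:R : R) => //.
  have [->|m1] := eqVneq m (onecm nat).
    by rewrite ifT//; apply/allP => j; rewrite -cmE_neq0 onecmE.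
  rewrite ifF//; apply/negbTE; apply: contra m1 => /allP m1; apply/eqP.
  apply: monom_eq => j; rewrite onecmE; apply/eqP; rewrite cmE_eq0.
  by apply/negP => /m1.
rewrite !big_nat_recr//=.
transitivity (fps_mul (\prod_(0 <= j < n) series_at q j) (series_at q n) m) => //.
have splitE a b : mulcm a b = m ->
    all (fun j => j < n)%N (finsupp a) -> (finsupp b `<=` [fset n])%fset ->
    [/\ forall j, (j < n)%N -> a j = m j, forall j, (n <= j)%N -> a j = 0%N,
        b n = m n & forall j, j != n -> b j = 0%N].
  move=> abm /allP an /fsubsetP bn.
  have b0 j : j != n -> b j = 0%N.
    move=> jn; apply/eqP; rewrite cmE_eq0; apply: contra jn => /bn.
    by rewrite inE.
  have a0 j : (n <= j)%N -> a j = 0%N.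
    by move=> nj; apply/eqP; rewrite cmE_eq0; apply/negP => /an; rewrite ltnNge nj.
  split => //; last by rewrite -abm mulcmE a0.
  by move=> j jn; rewrite -abm mulcmE b0 ?addn0// ltn_eqF.
rewrite /fps_mul.
case: (boolP (all _ (finsupp m))) => [/allP mn|/allPn[j jm jn]]; last first.
  rewrite fsbig1// => -[a b] /= abm; rewrite IHn /series_at.
  case: ifP => [an|_]; last by rewrite mul0r.
  case: ifP => [bn|_]; last by rewrite mulr0.
  have [_ a0 _ b0] := splitE _ _ abm an bn.
  move: jn jm; rewrite ltnS -ltnNge -cmE_neq0 -abm mulcmE => nj.
  by rewrite a0 ?(ltnW nj)// b0// gtn_eqF.
(* The one factorization of [m] that contributes. *)
pose a := mono (restr n m); pose b := var_pow n (m n).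
have aE j : (j < n)%N -> a j = m j.
  by move=> jn; rewrite (mono_ord _ (Ordinal jn)) multinomE tnth_mktuple.
have a0 j : (n <= j)%N -> a j = 0%N.
  by move=> nj; rewrite monoE nth_default// size_tuple.
have abm : mulcm a b = m.
  apply: monom_eq => j; rewrite mulcmE var_powE.
  have [jn|jn|->] := ltngtP j n.
  - by rewrite aE// mul0n addn0.
  - rewrite a0 ?(ltnW jn)// mul0n; apply/esym/eqP.
    by rewrite cmE_eq0; apply/negP => /mn; rewrite ltnS leqNgt jn.
  - by rewrite a0// mul1n.
rewrite -(@fsbig_widen _ _ _ _ [set (a, b)]).
- rewrite fsbig_set1/= IHn ifT; last first.
    apply/allP => j; rewrite -cmE_neq0 ltnNge; apply: contra => nj.
    by rewrite a0.
  rewrite /series_at ifT; last first.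
    apply/fsubsetP => j; rewrite inE -cmE_neq0 var_powE [j == n]eq_sym.
    by case: (n == j).
  rewrite var_powE eqxx mul1n; congr (_ * _).
  by rewrite !big_nat; apply: eq_bigr => j /andP[_ jn]; rewrite aE.
- by move=> _ /= ->.
- move=> [c d] [/= cdm cd] /=; rewrite IHn /series_at.
  case: ifP => [cn|_]; last by rewrite mul0r.
  case: ifP => [dn|_]; last by rewrite mulr0.
  have [cE c0 dE d0] := splitE _ _ cdm cn dn.
  case: cd; congr (_, _); apply: monom_eq => j.
    by have [nj|jn] := leqP n j; [rewrite c0 ?a0|rewrite cE ?aE].
  rewrite var_powE; have [<-|nj] := eqVneq n j; first by rewrite mul1n.
  by rewrite d0 ?mul0n// eq_sym.
Qed.

(** The coefficient of [m] in the partial products is constant once they include every variable of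
    [m]; the other variables contribute [q 0 = 1]. *)
Lemma fps_prod_series_at q (m : monom) : q 0 = 1 ->
  fps_prod (fun j => series_at q j) m = \prod_(k <- exponents m) q k.
Proof.
move=> q0; apply: lim_near_cst => //; near=> n.
have mn i : i \in finsupp m -> (i < n)%N.
  move=> im; apply: leq_trans (_ : msupp_bound m <= n)%N.
    by rewrite ltnS; apply: leq_bigmax_seq.
  by near: n; exact: nbhs_infty_ge.
by rewrite prod_series_at// (introT allP mn); apply: prod_exponents.
Unshelve. all: by end_near. Qed.

End InfiniteProduct.

(** * Comparison of coefficients *)

Section Uniqueness.
Variable R : comNzRingType.

(* The exponents of the monomial that [eval_elem] maps to [elem_part R l]. *)
Definition part_mult (i : nat) (l : seq nat) : multinom i :=
  Multinom [tuple count_mem j.+1 l | j < i].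

Lemma part_multE i l (j : 'I_i) : part_mult i l j = count_mem j.+1 l.
Proof. by rewrite multinomE tnth_mktuple. Qed.

Lemma eval_elemE i (P : mpoly i R) :
  eval_elem P = mmap (GRing.in_alg (fps R)) (fun j : 'I_i => elem_fps R j.+1) P.
Proof. by []. Qed.

Lemma is_partition_bound i l : is_partition i l -> all (fun k => 0 < k <= i)%N l.
Proof.
move=> /and3P[_ /allP l0 /eqP <-]; apply/allP => k kl.
by rewrite l0// mem_le_sumn.
Qed.

Lemma elem_part_mult i (l : seq nat) : all (fun k => 0 < k <= i)%N l ->
  elem_part R l = \prod_(j < i) elem_fps R j.+1 ^+ part_mult i l j.
Proof.
rewrite /elem_part; elim: l => [_|k l IHl /= /andP[/andP[k0 ki] /IHl IH]].
  by rewrite big_nil big1// => j _; rewrite part_multE.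
rewrite big_cons IH.
under [RHS]eq_bigr do rewrite part_multE /= exprD.
under [in LHS]eq_bigr do rewrite part_multE.
rewrite big_split/=; congr (_ * _).
(* Variables of the polynomial are numbered from 0, so [e_k] belongs to index [k - 1]. *)
have ki' : (k.-1 < i)%N by rewrite prednK.
rewrite (bigD1 (Ordinal ki'))//= prednK// eqxx expr1 big1 ?mulr1// => j jk.
suff -> : (k == j.+1) = false by [].
by apply: contraNF jk => /eqP kj; apply/eqP/val_inj; rewrite /= kj.
Qed.

Lemma eval_elem_mult i (l : seq nat) : is_partition i l ->
  eval_elem (mpolyX R (part_mult i l)) = elem_part R l.
Proof.
by move=> /is_partition_bound li; rewrite (elem_part_mult li) eval_elemE mmapX.
Qed.

Lemma part_mult_inj i l1 l2 : is_partition i l1 -> is_partition i l2 ->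
  part_mult i l1 = part_mult i l2 -> l1 = l2.
Proof.
move=> p1 p2 E; apply: (partition_inj p1 p2); apply/allP => k.
rewrite mem_cat => kl.
have /andP[k0 ki] : (0 < k <= i)%N.
  by case/orP: kl => /(allP (is_partition_bound _)); apply; eassumption.
have ki' : (k.-1 < i)%N by rewrite prednK.
have := congr1 (fun m : multinom i => m (Ordinal ki')) E.
by rewrite !part_multE /= prednK// => ->.
Qed.

Lemma truncates_eval_elem i (P : mpoly i R) :
  truncates (eval_elem P) (comp_mpoly [tuple mesym i R j.+1 | j < i] P).
Proof.
apply: truncates_sum => m _; apply: truncatesM.
  by rewrite -alg_mpolyC; apply: truncatesZ; exact: truncates1.
apply: truncates_prod => j _; rewrite tnth_mktuple; apply: truncatesX.
exact: truncates_elem.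
Qed.

(* Setting t_(i+1) = t_(i+2) = ... = 0 reduces this to the algebraic          *)
(* independence of the elementary symmetric polynomials in i variables.       *)
Lemma eval_elem_inj i : injective (@eval_elem R i).
Proof.
move=> P1 P2 E; apply: msym_fundamental_un; apply/mpolyP => k.
by rewrite -!truncates_eval_elem E.
Qed.

End Uniqueness.

(** Both sequences start at 1 and satisfy the same recurrence, which determines the next term
    because [k + 1] is invertible. *)
Lemma zeta_elem_sym (R : realType)
    (zeta : {lrmorphism Sym rat -> R | ratr \; *%R}) (k : nat) :
  zeta (power_sym rat 1) = euler_gamma R ->
  (forall i, (2 <= i)%N -> zeta (power_sym rat i) = zeta_value R i) ->
  zeta (elem_sym rat k) = recip_gamma_coef R k.
Proof.
move=> zeta1 zeta_ge2; elim/ltn_ind: k => -[_|k IHk].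
  by rewrite elem_sym0 rmorph1 recip_gamma_coef0.
have k0 : k.+1%:R != 0 :> R by rewrite pnatr_eq0.
apply: (mulfI k0); rewrite recip_gamma_coef_rec.
have := congr1 zeta (newton_sym rat k); rewrite rmorphM rmorph_nat rmorph_sum => ->.
apply: eq_bigr => j _; rewrite !rmorphM rmorphXn rmorphN1.
rewrite mulrAC; congr (_ * _ * _).
  by case: j => [|j]; [exact: zeta1|exact: zeta_ge2].
by apply: IHk; rewrite ltnS leq_subr.
Qed.

Lemma homogeneous_component_zeta (R : realType)
    (zeta : {lrmorphism Sym rat -> R | ratr \; *%R}) (i : nat) :
  zeta (power_sym rat 1) = euler_gamma R ->
  (forall i, (2 <= i)%N -> zeta (power_sym rat i) = zeta_value R i) ->
  homogeneous_component i (fps_prod (fun j => series_at (recip_gamma_coef R) j)) =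
  \sum_(l <- partitions i) zeta (monomial_sym rat l) *: elem_part R l.
Proof.
move=> zeta1 zeta_ge2; apply/funext => m; rewrite fps_sumE /homogeneous_component.
transitivity (\sum_(l <- partitions i)
    zeta (monomial_sym rat l) * elem_part R l m); last by [].
case: eqP => [<-|/eqP mi]; last first.
  rewrite big_seq big1// => l; rewrite mem_partitions => /and3P[_ _ /eqP li].
  by rewrite elem_part_homog ?mulr0// li.
rewrite fps_prod_series_at ?recip_gamma_coef0//.
(* The coefficient of [m] is a product of Taylor coefficients, hence the image under zeta of the
   product of the [e_k] over the exponents of [m]; [prod_elem_sym] expands the latter in monomial
   functions. *)
under eq_bigr do rewrite -(zeta_elem_sym _ zeta1 zeta_ge2).
rewrite -rmorph_prod prod_elem_sym raddf_sum; apply: eq_bigr => l _.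
transitivity (ratr (elem_part rat l m) * zeta (monomial_sym rat l)).
  exact: linearZ_LR.
by rewrite ratr_elem_part mulrC.
Qed.

Theorem mainTheorem1 (R : realType)
    (zeta : {lrmorphism Sym rat -> R | ratr \; *%R})
    (zeta1 : zeta (power_sym rat 1) = euler_gamma R)
    (zeta_ge2 : forall i, (2 <= i)%N ->
      zeta (power_sym rat i) = zeta_value R i)
    (Q : forall i, mpoly i R)
    (HQ : multiplicative_sequence (@recip_gamma_coef R) Q)
    (i : nat) :
  (forall l : seq nat, is_partition i l ->
     coef_elem_part l (Q i) = zeta (monomial_sym rat l)) /\
  eval_elem (Q i) =
    \sum_(l \in [set l | is_partition i l])
      zeta (monomial_sym rat l) *: elem_part R l.
Proof.
rewrite sum_partitions.
have QE : eval_elem (Q i) =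
    \sum_(l <- partitions i) zeta (monomial_sym rat l) *: elem_part R l.
  by rewrite HQ (homogeneous_component_zeta _ zeta1 zeta_ge2).
split => // l li.
(* Both polynomials have the same value at the elementary functions, so injectivity of [eval_elem]
   identifies them. The coefficients can then be read off, distinct partitions giving distinct
   exponent vectors. *)
have -> : Q i = \sum_(l <- partitions i)
    zeta (monomial_sym rat l) *: mpolyX R (part_mult i l).
  apply: eval_elem_inj; rewrite QE eval_elemE raddf_sum.
  rewrite !big_seq; apply: eq_bigr => l'; rewrite mem_partitions => li'.
  rewrite -mulr_algl -(eval_elem_mult R li'); apply/esym; exact: mmapZ.
rewrite /coef_elem_part raddf_sum (bigD1_seq l) ?mem_partitions ?uniq_partitions//=.
rewrite mcoeffZ mcoeffX eqxx mulr1 big_seq_cond big1 ?addr0// => l' /andP[].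
rewrite mem_partitions => li' ll'.
rewrite mcoeffZ mcoeffX; case: eqP => [E|]; last by rewrite mulr0.
by case/eqP: ll'; exact: part_mult_inj li' li E.
Qed.
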